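(* Let $\omega$ be a permutation, $\mathcal T$ its tower diagram and $D=D_\omega$ its Rothe diagram. Then there is a bijective correspondence between the set $\mathrm{SSTT}(\mathcal T)$ of all semi-standard tower tableaux of shape $\mathcal T$ and the set $\mathrm{BL}(D)$ of all balanced labellings of $D$, given by sending a balanced labelling $B$ to the tower tableau of shape $\mathcal T$ whose tower with index $c$ carries, from bottom to top, the labels of $B$ in column $c$ of $D$ arranged in non-decreasing order. The inverse bijection is given by the Rothification $T\mapsto R_T$ of semi-standard tower tableaux.
   Context: Permutations are written in one-line notation $\omega=\omega_1\cdots\omega_n$; $s_a=(a,a+1)$ and $\omega s_a$ swaps the entries in positions $a,a+1$; a reduced word of $\omega$ is a word $\alpha_1\cdots\alpha_l$ with $\omega=s_{\alpha_1}\cdots s_{\alpha_l}$, $l$ the number of inversions of $\omega$. A tower diagram is a finite sequence $(\mathcal T_1,\mathcal T_2,\ldots)$ of towers; the $i$-th tower of size $k_i\ge0$ consists of the cells $(i,0),\ldots,(i,k_i-1)$, the cell $(i,j)$ being the unit square $[i-1,i]\times[j,j+1]$ identified with its south-east corner, lying on the diagonal $x+y=i+j$; $i$ is its tower index. A tower tableau of shape $\mathcal T$ is a function from the cells of $\mathcal T$ to the positive integers (labels). Sliding. For a positive integer $a$ and a tail $(\mathcal T_p,\ldots)$ of a tower diagram, $a^{\searrow}(\mathcal T_p,\ldots)$ either adds one cell or terminates: (S1) if no tower $\mathcal T_t$, $t\ge p$, has a cell on $x+y=a-1$: (a) if none has a cell on $x+y=a$, add $(a,0)$; (b) if $(a,0)\in\mathcal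 T_a$, $(a,1)\notin\mathcal T_a$, terminate; (c) if $(a,0),(a,1)\in\mathcal T_a$, result is $(a+1)^{\searrow}(\mathcal T_{a+1},\ldots)$. (S2) Otherwise, with $\mathcal T_i$ ($i\ge p$) the leftmost tower having a cell $(i,a-1-i)$: (a) if $(i,a-i)\notin\mathcal T_i$, add it; (b) if $(i,a-i)\in\mathcal T_i$, $(i,a-i+1)\notin\mathcal T_i$, terminate; (c) if both are in $\mathcal T_i$, result is $(a+1)^{\searrow}(\mathcal T_{i+1},\ldots)$. Sliding $a$ into $\mathcal T$ is $a^{\searrow}(\mathcal T_1,\ldots)$. Sliding a word letter by letter into the empty diagram (no step terminating), labelling the cell created by the $k$-th letter with $k$, gives the standard tower tableau of the word (its reading word); this works exactly for reduced words. The tower diagram of $\omega$ is the common shape of the standard tower tableaux of the reduced words of $\omega$. Corners: a cell $c$ of a tower diagram $\mathcal T$ is a corner if it is the top cell of its tower and there is a positive integer $f$ (its flight number) with $f^{\searrow}(\mathcal T\setminus\{c\})=\mathcal T$ (the flight algorithm). Semi-standard: the empty tableau is semi-standard; a nonempty tower tableau $T$ with maximal label $n$ is semi-standard if the set $C_T$ of corner cells of its shape carrying label $n$ is nonempty and, for the cell $c\in C_T$ with minimal flight number, the restriction of $T$ to the shape with $c$ removed is semi-standard. Standardization $S(T)$ of a semi-standard $T$ with $m$ cells: $S(T)$ is the standard tower tableau of the same shape in which $c$ (as just defined) has label $m$ and whose restriction to the shape minus $c$ is $S$ of the restriction of $T$ (for one cell, the unique standard tableau). Rothe diagram: $D_\omega=\{(i,\omega_j):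 i<j,\ \omega_i>\omega_j\}$, $(r,c)$ meaning row $r$ (rows numbered top to bottom), column $c$. The hook of $(i,j)\in D_\omega$ is $H_{(i,j)}(\omega)=\{(r,j)\in D_\omega: r\ge i\}\cup\{(i,s)\in D_\omega: s\ge j\}$. A labelling $B:D_\omega\to\mathbb Z_{>0}$ is balanced if for every $(i,j)\in D_\omega$ the following holds: list the cells of $H_{(i,j)}(\omega)$ starting at the bottom cell of its column part, going up to $(i,j)$, then going right along its row part; rearranging the labels of the hook so that they weakly decrease along this list does not change the label at $(i,j)$. Rothification of a standard tableau $T$ with reading word $\alpha_1\cdots\alpha_l$: let $T'$ be the standard tower tableau of $\alpha_l\cdots\alpha_1$, $u_r$ the cell of $T$ labelled $r$ and $v_r$ the cell of $T'$ labelled $l+1-r$; $R_T$ puts label $r$ on the cell in row (tower index of $v_r$), column (tower index of $u_r$). Rothification of a semi-standard $T$: $R_T$ has the same cells as $R_{S(T)}$, and the cell labelled $r$ in $R_{S(T)}$ receives the label that $T$ gives to the cell of $\mathcal T$ labelled $r$ in $S(T)$. *)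

(* Defs.v *)
From mathcomp Require Import all_boot fingroup perm.
From mathcomp Require Import classical_sets functions.

Set Implicit Arguments.
Unset Strict Implicit.
Unset Printing Implicit Defensive.

(* A tower diagram is the sequence of its tower sizes and a tower tableau the
   sequence of its towers, each tower being its labels listed from bottom to
   top.  The i-th tower, i >= 1, is therefore the item of index i.-1.  Cells
   are pairs (i, j) with i >= 1 the tower index and j >= 0 the height. *)
Definition diagram := seq nat.
Definition tableau := seq (seq nat).
Definition cell := (nat * nat)%type.

Implicit Types (D : diagram) (T U : tableau) (c : cell) (alpha : seq nat).

Definition shape T : diagram := map size T.

Definition tower_tableau T : bool := all (all (fun x => 0 < x)) T.

Definition has_cell D (i j : nat) : bool := (0 < i) && (j < nth 0 D i.-1).

Definition cells D : seq cell :=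
  [seq (i, j) | i <- iota 1 (size D), j <- iota 0 (nth 0 D i.-1)].

(* [c] is meant to be the top cell of its tower. *)
Definition remove_cell D c : diagram := set_nth 0 D c.1.-1 c.2.

Definition label T c : nat := nth 0 (nth [::] T c.1.-1) c.2.

Definition put_label T c (x : nat) : tableau :=
  set_nth [::] T c.1.-1 (set_nth 0 (nth [::] T c.1.-1) c.2 x).

(* The restriction of [T] to its shape minus the top cell [c] of a tower. *)
Definition restrict T c : tableau :=
  set_nth [::] T c.1.-1 (take c.2 (nth [::] T c.1.-1)).

(* The cell of [T] labelled [r], when [r] occurs exactly once in [T]. *)
Definition cell_of_label T (r : nat) : cell :=
  let i := find (fun t => r \in t) T in (i.+1, index r (nth [::] T i)).

(** Sliding *)

(* Tower [i] has a cell on the diagonal x + y = d. *)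
Definition meets D (d i : nat) : bool := (i <= d) && has_cell D i (d - i).

(* The leftmost tower of index at least [p] with a cell on x + y = d. *)
Definition leftmost D (p d : nat) : option nat :=
  ohead [seq i <- iota p (size D) | meets D d i].

(* Slides [a] into the towers of [D] of index at least [p]; the result is the
   added cell, or [None] if the sliding terminates.  The argument [m] only
   bounds the number of recursive calls, see [slide_fromE]. *)
Fixpoint slide_rec (m : nat) D (p a : nat) : option cell :=
  if m is m'.+1 then
    if leftmost D p a.-1 is Some i then
      if ~~ has_cell D i (a - i) then Some (i, a - i)
      else if ~~ has_cell D i (a - i).+1 then None
      else slide_rec m' D i.+1 a.+1
    else
      if leftmost D p a is None then Some (a, 0)
      else if ~~ has_cell D a 1 then None
      else slide_rec m' D a.+1 a.+1
  else None.

Definition slide_from D (p a : nat) : option cell :=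
  slide_rec (size D).+1 D p a.

Definition slide D (a : nat) : option cell := slide_from D 1 a.

Lemma leftmostP D p d i : leftmost D p d = Some i -> (p <= i) && meets D d i.
Proof.
rewrite /leftmost => H.
have : i \in [seq i <- iota p (size D) | meets D d i].
  by case: [seq _ <- _ | _] H => //= x s [->]; rewrite inE eqxx.
by rewrite mem_filter mem_iota => /and3P[-> ->].
Qed.

Lemma has_cell_size D i j : has_cell D i j -> i <= size D.
Proof.
rewrite /has_cell; case: i => //= i; case: (ltnP i (size D)) => // h.
by rewrite nth_default.
Qed.

Lemma slide_rec_fuel m m' D p a :
    p <= a -> (size D).+1 - p < m -> (size D).+1 - p < m' ->
  slide_rec m D p a = slide_rec m' D p a.
Proof.
elim: m m' p a => // m IH [//|m'] p a pa; rewrite !ltnS => hm hm' /=.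
have step i b : p <= i -> i <= b -> i <= size D ->
    slide_rec m D i.+1 b.+1 = slide_rec m' D i.+1 b.+1.
  move=> pi ib iD; have h : size D - i < (size D).+1 - p.
    by rewrite -subSn // leq_sub2l.
  by apply: IH; rewrite ?ltnS ?subSS // (leq_trans h).
case E: leftmost => [i|]; last first.
  case: leftmost => // _; case: ifP => // /negbFE ha.
  by apply: step => //; apply: has_cell_size ha.
case: ifP => // _; case: ifP => // _.
move/leftmostP: E => /and3P[pi ia hi]; apply: step => //.
  exact: leq_trans ia (leq_pred _).
exact: has_cell_size hi.
Qed.

Lemma slide_fromE D p a : 0 < p <= a ->
  slide_from D p a =
    if leftmost D p a.-1 is Some i then
      if ~~ has_cell D i (a - i) then Some (i, a - i)
      else if ~~ has_cell D i (a - i).+1 then None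
      else slide_from D i.+1 a.+1
    else
      if leftmost D p a is None then Some (a, 0)
      else if ~~ has_cell D a 1 then None
      else slide_from D a.+1 a.+1.
Proof.
case/andP=> p0 pa; have -> : slide_from D p a = slide_rec (size D).+2 D p a.
  by apply: slide_rec_fuel; rewrite // ltnS ?leq_subr // leq_subLR
       addnC -addn1 leq_add2l.
by [].
Qed.

(* The tableau obtained by sliding the letters of [alpha], with labels from
   [k] on, into [T]; [None] if some sliding terminates. *)
Fixpoint slide_word T (k : nat) alpha : option tableau :=
  if alpha is a :: alpha' then
    if slide (shape T) a is Some c then
      slide_word (put_label T c k) k.+1 alpha'
    else None
  else Some T.

(* The empty diagram is presented here with [n] empty towers, so that all the
   diagrams attached to permutations of 1, ..., n have exactly [n] towers. *)
Definition std_tableau (n : nat) alpha : option tableau :=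
  if all (fun a => 0 < a) alpha then slide_word (nseq n [::]) 1 alpha else None.

Definition reading_word T : seq nat :=
  xget [::] (fun alpha => std_tableau (size T) alpha = Some T).

(** Corners and flight numbers *)

Definition is_flight D c (f : nat) : bool :=
  (0 < f) && (slide (remove_cell D c) f == Some c).

(* The flight number of [c], or 0 if there is none. *)
Definition flight D c : nat :=
  head 0 [seq f <- iota 1 (c.1 + c.2) | is_flight D c f].

Lemma slide_rec_diag m D p a c : slide_rec m D p a = Some c -> a <= c.1 + c.2.
Proof.
elim: m p a => // m IH p a /=; case E: leftmost => [i|]; last first.
  case: leftmost => [_|[<-]]; last by rewrite addn0.
  by case: ifP => // _ /IH /ltnW.
case: ifP => _; last by case: ifP => // _ /IH /ltnW.
move=> [<-] /=; rewrite -leq_subLR //.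
Qed.

Lemma is_flight_bound D c f : is_flight D c f -> f <= c.1 + c.2.
Proof. by case/andP=> _ /eqP /slide_rec_diag. Qed.

Lemma flightP D c : reflect (exists f, is_flight D c f) (0 < flight D c).
Proof.
rewrite /flight; set s := [seq f <- _ | _].
have memP f : (f \in s) = is_flight D c f.
  rewrite mem_filter mem_iota add1n ltnS.
  case H: (is_flight D c f) => //=.
  by rewrite (is_flight_bound H) andbT; case/andP: H.
case: s memP => [|f s] memP; apply: (iffP idP) => //=.
- by case=> f; rewrite -memP.
- by move=> _; exists f; rewrite -memP mem_head.
- by have := mem_head f s; rewrite memP => /andP[].
Qed.

Definition corner D c : bool :=
  [&& has_cell D c.1 c.2, ~~ has_cell D c.1 c.2.+1 & 0 < flight D c].

(** Semi-standard tableaux *)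

Definition max_label T : nat := foldr maxn 0 (flatten T).

Definition max_corners T : seq cell :=
  [seq c <- cells (shape T) | corner (shape T) c & label T c == max_label T].

Definition pivot T : option cell :=
  let C := max_corners T in
  ohead [seq c <- C | all (fun d => flight (shape T) c <= flight (shape T) d) C].

(* [m] is the number of cells of [T]. *)
Fixpoint semistd_rec (m : nat) T : bool :=
  if m is m'.+1 then
    if pivot T is Some c then semistd_rec m' (restrict T c) else false
  else true.

Definition semistandard T : bool := semistd_rec (size (flatten T)) T.

Fixpoint stdz_rec (m : nat) T : tableau :=
  if m is m'.+1 then
    if pivot T is Some c then put_label (stdz_rec m' (restrict T c)) c m else T
  else T.

Definition standardization T : tableau := stdz_rec (size (flatten T)) T.

Definition SSTT D : set tableau :=
  fun T => [/\ shape T = D, tower_tableau T & semistandard T].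

(** Permutations.  The entry omega_i of the one-line notation is [w i], with
    both positions and values shifted down by 1 to lie in ['I_n]. *)

Definition inv_pairs n (w : 'S_n) : {set 'I_n * 'I_n} :=
  [set p : 'I_n * 'I_n | (p.1 < p.2) && (w p.2 < w p.1)].

(* Letters [a] with 1 <= a < n stand for the transposition of the positions
   a and a + 1, that is of the ordinals a - 1 and a. *)
Definition simple_transposition n (a : nat) : 'S_n :=
  if (insub a.-1, insub a) is (Some i, Some j) then tperm i j else 1%g.

(* omega s_a is the composite of functions, hence [s_a * omega] in the group
   ['S_n], where permutations act on the right. *)
Definition word_perm n alpha : 'S_n :=
  foldl (fun w a => (simple_transposition n a * w)%g) 1%g alpha.

Definition reduced_word n (w : 'S_n) alpha : bool :=
  [&& all (fun a => 0 < a < n) alpha, word_perm n alpha == w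
    & size alpha == #|inv_pairs w|].

Definition tower_diagram n (w : 'S_n) D : Prop :=
  forall alpha, reduced_word w alpha ->
    exists2 T, std_tableau n alpha = Some T & shape T = D.

(** Rothe diagrams, with pairs (row, column), and balanced labellings.  A
    labelling is extended by 0 outside of the diagram. *)

Definition rothe n (w : 'S_n) : {set 'I_n * 'I_n} :=
  [set (p.1, w p.2) | p in inv_pairs w].

Definition labelling n := {ffun 'I_n * 'I_n -> nat}.

(* The part of the hook of [x] below [x], read upwards, and its part to the
   right of [x]. *)
Definition leg n (w : 'S_n) (x : 'I_n * 'I_n) : seq ('I_n * 'I_n) :=
  [seq (r, x.2) | r : 'I_n <- rev (enum 'I_n) & (x.1 < r) && ((r, x.2) \in rothe w)].

Definition arm n (w : 'S_n) (x : 'I_n * 'I_n) : seq ('I_n * 'I_n) :=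
  [seq (x.1, s) | s : 'I_n <- enum 'I_n & (x.2 < s) && ((x.1, s) \in rothe w)].

Definition hook n (w : 'S_n) (x : 'I_n * 'I_n) : seq ('I_n * 'I_n) :=
  leg w x ++ x :: arm w x.

Definition balanced n (w : 'S_n) (B : labelling n) : Prop :=
  forall x, x \in rothe w ->
    nth 0 (sort geq (map B (hook w x))) (size (leg w x)) = B x.

Definition BL n (w : 'S_n) : set (labelling n) :=
  fun B => (forall x, (0 < B x) = (x \in rothe w)) /\ balanced w B.

Definition sort_columns n (w : 'S_n) (B : labelling n) : tableau :=
  [seq sort leq [seq B (r, c) | r : 'I_n <- enum 'I_n & (r, c) \in rothe w]
  | c : 'I_n <- enum 'I_n].

(** Rothification *)

(* The row and the column of the label [r] in the Rothification of the
   standard tableau [U]. *)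
Definition rothify_cell U (r : nat) : nat * nat :=
  let alpha := reading_word U in
  let U' := odflt [::] (std_tableau (size U) (rev alpha)) in
  ((cell_of_label U' ((size alpha).+1 - r)).1, (cell_of_label U r).1).

(* 0 outside of the diagram. *)
Definition rothify_std n U : labelling n :=
  [ffun x : 'I_n * 'I_n => head 0 [seq r <- iota 1 (size (flatten U))
                    | rothify_cell U r == (x.1.+1, x.2.+1)]].

Definition rothify n T : labelling n :=
  let U := standardization T in let R := rothify_std n U in
  [ffun x : 'I_n * 'I_n => if R x == 0 then 0 else label T (cell_of_label U (R x))].

(* Main.v *)
From Pilot Require Import Defs.
From mathcomp Require Import all_boot fingroup perm.
From mathcomp Require Import classical_sets functions.
From mathcomp Require Import zify.
(* [classical_sets] and [functions] shadow [meets] and [restrict]. *)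
Import Pilot.Defs.

Set Implicit Arguments.
Unset Strict Implicit.
Unset Printing Implicit Defensive.

(** Everything is removed one cell at a time.  For a descent [i] of [w] and
    [v = w s_i], the tower diagram of [w] is that of [v] with a cell added on
    top of the tower [w (i+1)], its corner with flight number the descent, while
    the Rothe diagram of [w] is that of [v] with rows [i], [i+1] exchanged and
    the cell [(i, w (i+1))] added.  A labelling is balanced iff for every
    threshold [t] the pairs of positions [p < q] whose cell [(p, w q)] has a
    label [>= t] form a biclosed set, and this property is inherited in both
    directions when a cell of maximal label is added at a descent.  Among the
    descents whose column contains the maximal label, the smallest one does
    carry it at [(i, w (i+1))]; so the removal of the pivot from a tower tableau
    and the removal of this cell from a labelling correspond to each other under
    the sorting of columns, and both maps are determined by recursion. *)

(** Balance only counts: after sorting, the label at the corner of a hook reaches [t] iff more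
    labels of the hook reach [t] than its leg has cells. Such counts do not pass easily from [w] to
    [w s_i], whereas biclosedness involves three positions at a time and, over all thresholds,
    becomes the inequality [triple_balanced] between three labels. Deducing it from the counts is
    the difficult direction. On the tableau side, the tower sizes are identified with the column
    counts of the Rothe diagram, so sorted columns have the right shape, and a letter sliding into
    such a diagram can be followed explicitly. Since Rothification takes its rows from the reversed
    reading word, the induction on tableaux carries a reduced word of [w] whose standard tableau is
    the standardization. *)

Lemma val_tperm n (i i' p : 'I_n) : i' = i.+1 :> nat ->
  tperm i i' p = (if p == i :> nat then i.+1
                  else if p == i.+1 :> nat then i else p) :> nat.
Proof.
move=> hi; rewrite -hi; case: tpermP => [->|->|h1 h2].
- by rewrite eqxx.
- by rewrite eqxx; case: eqP.
- by rewrite !val_eqE (negbTE (introN eqP h1)) (negbTE (introN eqP h2)).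
Qed.

Lemma ltn_tperm n (i i' p q : 'I_n) : i' = i.+1 :> nat ->
    ~~ ((p == i :> nat) && (q == i' :> nat)) ->
    ~~ ((p == i' :> nat) && (q == i :> nat)) ->
  (tperm i i' p < tperm i i' q) = (p < q).
Proof. by move=> hi; rewrite !val_tperm // hi; do ?case: ifP; lia. Qed.

Lemma perm_val_inj n (w : 'S_n) (p q : 'I_n) :
  w p = w q :> nat -> p = q :> nat.
Proof. by move/val_inj/perm_inj ->. Qed.

Lemma mem_rothe n (w : 'S_n) (p q : 'I_n) :
  ((p, w q) \in rothe w) = (p < q) && (w q < w p).
Proof.
apply/imsetP/idP => [[[a b]]|h]; last by exists (p, q); rewrite ?inE.
by rewrite inE /= => /andP[h1 h2] [-> /perm_inj ->]; rewrite h1.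
Qed.

Lemma mem_rotheV n (w : 'S_n) (p c : 'I_n) :
  ((p, c) \in rothe w) = (p < w^-1%g c) && (c < w p).
Proof. by rewrite -{1}(permKV w c) mem_rothe permKV. Qed.

(** * Inversions and reduced words *)

(** Exchanging [i] and [i'] in both coordinates matches the inversions of [w] with those of the
    longer permutation other than [(i, i')]. *)
Lemma card_inv_pairs_tperm n (w : 'S_n) (i i' : 'I_n) : i' = i.+1 :> nat ->
  w i < w i' -> #|inv_pairs (tperm i i' * w)%g| = #|inv_pairs w|.+1.
Proof.
move=> hi wi.
pose f (p : 'I_n * 'I_n) := (tperm i i' p.1, tperm i i' p.2).
have fK : involutive f by move=> [a b]; rewrite /f /= !tpermK.
rewrite (cardsD1 (i, i')) !inE /= !permM tpermL tpermR hi ltnSn wi add1n.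
congr _.+1; rewrite -[RHS](card_imset _ (inv_inj fK)); apply: eq_card => -[a b].
apply/idP/idP => [|/imsetP [[c d]]]; rewrite !inE /= ?permM.
  move=> /and3P[ne ab wab]; apply/imsetP; exists (f (a, b)); rewrite ?fK //.
  rewrite inE /= wab andbT ltn_tperm // -?val_eqE //=; last lia.
move=> /andP[cd wcd] [-> ->]; rewrite !tpermK wcd andbT.
have ne : ~~ ((c == i :> nat) && (d == i' :> nat)).
  apply/negP => /andP[/eqP/val_inj E1 /eqP/val_inj E2].
  by move: wcd wi; rewrite E1 E2; lia.
have ne' : ~~ ((c == i' :> nat) && (d == i :> nat)) by lia.
rewrite ltn_tperm // cd andbT xpair_eqE -!val_eqE /= !val_tperm // hi.
by do ?case: ifP; lia.
Qed.

Lemma simple_transpositionE n a : 0 < a < n ->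
  exists i i' : 'I_n, [/\ i' = i.+1 :> nat, a = i.+1
    & simple_transposition n a = tperm i i'].
Proof.
move=> /andP[a0 an]; have an1 : a.-1 < n by lia.
exists (Ordinal an1), (Ordinal an); split=> //=; try lia.
by rewrite /simple_transposition !insubT.
Qed.

Lemma simple_transposition_ord n (i i' : 'I_n) : i' = i.+1 :> nat ->
  simple_transposition n i.+1 = tperm i i'.
Proof.
move=> hi; have [|j [j' [hj [ij] ->]]] := @simple_transpositionE n i.+1.
  by have := ltn_ord i'; lia.
by congr tperm; apply: val_inj => //=; lia.
Qed.

Lemma word_perm_cat n alpha beta :
  word_perm n (alpha ++ beta) = (word_perm n beta * word_perm n alpha)%g.
Proof.
rewrite /word_perm foldl_cat; move: (foldl _ _ alpha) => u.
elim/last_ind: beta => [|beta b IH]; first by rewrite mul1g.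
by rewrite !foldl_rcons IH mulgA.
Qed.

Lemma word_perm_rcons n alpha a :
  word_perm n (rcons alpha a) = (simple_transposition n a * word_perm n alpha)%g.
Proof. by rewrite /word_perm foldl_rcons. Qed.

Lemma word_perm_cons n a alpha :
  word_perm n (a :: alpha) = (word_perm n alpha * simple_transposition n a)%g.
Proof. by rewrite -cat1s word_perm_cat /word_perm /= mulg1. Qed.

Lemma word_perm_rev n alpha : all (fun a => 0 < a < n) alpha ->
  word_perm n (rev alpha) = (word_perm n alpha)^-1%g.
Proof.
elim: alpha => [|a alpha IH] /=; first by rewrite /word_perm /= invg1.
move=> /andP[ha hal]; rewrite rev_cons word_perm_rcons word_perm_cons IH //.
rewrite invMg; have [i [i' [_ _ ->]]] := simple_transpositionE ha.
by rewrite tpermV.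
Qed.

Lemma card_inv_pairsV n (w : 'S_n) : #|inv_pairs w^-1%g| = #|inv_pairs w|.
Proof.
pose f (p : 'I_n * 'I_n) := (w p.2, w p.1).
have f_inj : injective f by move=> [a b] [c d] [/perm_inj -> /perm_inj ->].
rewrite -[RHS](card_imset _ f_inj); apply: eq_card => -[a b]; rewrite inE /=.
apply/andP/imsetP => [[h1 h2]|[[c d]]].
  by exists (w^-1 b, w^-1 a)%g; rewrite ?inE /f /= ?permKV ?h1 ?h2.
by rewrite inE => /andP[h1 h2] [-> ->] /=; rewrite !permK.
Qed.

Lemma card_inv_pairs1 n : #|inv_pairs (1%g : 'S_n)| = 0.
Proof. by apply: eq_card0 => -[a b]; rewrite !inE !perm1 /=; lia. Qed.

Lemma perm_ltn_neq n (w : 'S_n) (i i' : 'I_n) : i' = i.+1 :> nat ->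
  (w i' < w i) = ~~ (w i < w i').
Proof.
move=> hi; case: ltngtP => // /val_inj/perm_inj E; move: hi; rewrite E; lia.
Qed.

Lemma card_inv_pairs_tperm_desc n (w : 'S_n) (i i' : 'I_n) : i' = i.+1 :> nat ->
  w i' < w i -> #|inv_pairs w| = #|inv_pairs (tperm i i' * w)%g|.+1.
Proof.
move=> hi wi; rewrite -(card_inv_pairs_tperm hi) ?mulgA ?tperm2 ?mul1g //.
by rewrite !permM tpermL tpermR.
Qed.

Lemma card_inv_word_perm n alpha : all (fun a => 0 < a < n) alpha ->
  #|inv_pairs (word_perm n alpha)| <= size alpha.
Proof.
elim/last_ind: alpha => [|alpha a IH]; first by rewrite card_inv_pairs1.
rewrite all_rcons word_perm_rcons size_rcons => /andP[ha /IH].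
have [i [i' [hi _ ->]]] := simple_transpositionE ha.
set v := word_perm n alpha; case: (boolP (v i < v i')) => vi.
  by rewrite card_inv_pairs_tperm.
rewrite -perm_ltn_neq // in vi.
by move=> le; apply/leqW/ltnW; rewrite -(card_inv_pairs_tperm_desc hi vi).
Qed.

Lemma reduced_wordP n (w : 'S_n) alpha :
  reflect [/\ all (fun a => 0 < a < n) alpha, word_perm n alpha = w
            & size alpha = #|inv_pairs w|] (reduced_word w alpha).
Proof.
by apply: (iffP and3P) => -[h1 /eqP h2 /eqP h3].
Qed.

(** The prefix yields at most as many inversions as it has letters, so the length can only be right
    if the last letter creates an inversion. *)
Lemma reduced_word_rcons n (w : 'S_n) alpha a :
    reduced_word w (rcons alpha a) ->
  exists i i' : 'I_n, [/\ i' = i.+1 :> nat, a = i.+1, w i' < w i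
    & reduced_word (tperm i i' * w)%g alpha].
Proof.
case/reduced_wordP; rewrite all_rcons word_perm_rcons size_rcons.
move=> /andP[ha hal]; have [i [i' [hi ai ->]]] := simple_transpositionE ha.
have le := card_inv_word_perm hal; set v := word_perm n alpha in le *.
move=> <- hs; exists i, i'; split=> //; last first.
  apply/reduced_wordP; split=> //; rewrite mulgA tperm2 mul1g //.
  case: (boolP (v i < v i')) => vi.
    by apply/eq_add_S; rewrite hs (card_inv_pairs_tperm hi vi).
  rewrite -perm_ltn_neq // in vi; move: le.
  by rewrite (card_inv_pairs_tperm_desc hi vi) -hs ltnNge leqW.
rewrite !permM tpermL tpermR ltnNge; apply/negP => vi.
have {}vi : v i' < v i.
  by rewrite perm_ltn_neq // -leqNgt.
by move: le; rewrite (card_inv_pairs_tperm_desc hi vi) -hs ltnNge leqW.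
Qed.

Lemma rcons_reduced_word n (w : 'S_n) (i i' : 'I_n) alpha :
    i' = i.+1 :> nat -> w i' < w i ->
    reduced_word (tperm i i' * w)%g alpha ->
  reduced_word w (rcons alpha i.+1).
Proof.
move=> hi wi /reduced_wordP[h1 h2 h3]; apply/reduced_wordP.
have hn : i.+1 < n by rewrite -hi.
rewrite all_rcons hn h1 word_perm_rcons h2 size_rcons h3.
by rewrite (simple_transposition_ord hi) mulgA tperm2 mul1g -card_inv_pairs_tperm_desc.
Qed.

Lemma rev_reduced_word n (w : 'S_n) alpha :
  reduced_word w alpha -> reduced_word w^-1%g (rev alpha).
Proof.
case/reduced_wordP=> h1 h2 h3; apply/reduced_wordP.
by rewrite all_rev h1 word_perm_rev // h2 size_rev card_inv_pairsV.
Qed.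

Lemma perm_homo_ge n (w : 'S_n) : (forall p q : 'I_n, p < q -> w p < w q) ->
  forall i : 'I_n, i <= w i.
Proof.
move=> h [k kn]; elim: k kn => // k IH kn; apply: leq_ltn_trans (IH (ltnW kn)) _.
exact: h.
Qed.

(** Without inversions [w] and its inverse are both increasing, hence both lie above the
    identity. *)
Lemma perm_no_inv n (w : 'S_n) : #|inv_pairs w| = 0 -> w = 1%g.
Proof.
move/eqP; rewrite cards_eq0 => /eqP E.
have h (p q : 'I_n) : p < q -> w p < w q.
  move=> pq; rewrite ltnNge leq_eqVlt; apply/negP => /orP[/eqP|].
    by move/val_inj/perm_inj; move: pq => /[swap] ->; rewrite ltnn.
  move=> wpq; have : (p, q) \in inv_pairs w by rewrite inE /= pq wpq.
  by rewrite E inE.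
have hV (p q : 'I_n) : p < q -> w^-1%g p < w^-1%g q.
  move=> pq; rewrite ltnNge leq_eqVlt; apply/negP => /orP[/eqP|/h].
    by move/val_inj/perm_inj; move: pq => /[swap] ->; rewrite ltnn.
  by rewrite !permKV ltnNge ltnW.
apply/permP => i; apply/val_inj; rewrite perm1.
apply/eqP; rewrite eqn_leq (perm_homo_ge h) andbT.
by have := perm_homo_ge hV (w i); rewrite permK.
Qed.

Lemma inv_desc n (w : 'S_n) (p q : 'I_n) : p < q -> w q < w p ->
  exists i i' : 'I_n, i' = i.+1 :> nat /\ w i' < w i.
Proof.
case: q => q hq; elim: q hq => // q IH hq; rewrite ltnS => pq wqp.
have hq' := ltnW hq; case: (ltnP (w (Ordinal hq')) (w p)) => h.
  move: pq; rewrite leq_eqVlt => /orP[/eqP E|/IH]; last exact.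
  by exists p, (Ordinal hq); rewrite /= E.
by exists (Ordinal hq'), (Ordinal hq); split=> //; lia.
Qed.

Lemma reduced_word_exists n (w : 'S_n) : exists alpha, reduced_word w alpha.
Proof.
move E: #|inv_pairs w| => m; elim: m w E => [|m IH] w E.
  exists [::]; apply/reduced_wordP; split=> //.
  by rewrite (perm_no_inv E).
have /card_gt0P[[p q]] : 0 < #|inv_pairs w| by rewrite E.
rewrite inE /= => /andP[pq wqp]; have [i [i' [hi wi]]] := inv_desc pq wqp.
move: E; rewrite (card_inv_pairs_tperm_desc hi wi) => -[/IH [alpha h]].
by exists (rcons alpha i.+1); apply: rcons_reduced_word h.
Qed.

(** * Balanced sets of inversions *)

(* A relation [I] on positions stands for the set of cells [(p, w q)] such that
   [I p q]; it will be the set of cells with labels at least some threshold. *)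
Section HookBalanced.
Variables (n : nat) (w : 'S_n) (I : rel 'I_n).

Definition hook_leg (r j : 'I_n) : nat :=
  \sum_(k : 'I_n) ((r < k < j) && (w j < w k)).

Definition leg_count (r j : 'I_n) : nat := \sum_(k : 'I_n) ((r < k < j) && I k j).

Definition arm_count (r j : 'I_n) : nat := \sum_(k : 'I_n) ((w j < w k) && I r k).

Definition inversion_rel : Prop := forall p q, I p q -> (p < q) && (w q < w p).

(** The sorted hook shows at its corner the entry of index [hook_leg], counted from 0; it reaches a
    threshold iff more than [hook_leg] labels do. *)
Definition hook_balanced : Prop := forall r j : 'I_n, r < j -> w j < w r ->
  I r j = (hook_leg r j < I r j + leg_count r j + arm_count r j).

(** Closed with closed complement, the property that characterizes inversion sets of
    permutations. *)
Definition biclosed : Prop := forall p q r : 'I_n, p < q -> q < r ->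
  (I p q -> I q r -> I p r) /\ (I p r -> I p q || I q r).

(** Both sides are compared position by position. If [I r j], each leg position [k] has [I r k] or
    [I k j]. If not, no [k] between [r] and [j] has both, and an arm cell with [k] beyond [j] would
    force [I j k] against the order of the columns. *)
Lemma biclosed_hook_balanced : inversion_rel -> biclosed -> hook_balanced.
Proof.
move=> Iinv bI r j rj wjr; rewrite /hook_leg -addnA /leg_count /arm_count.
rewrite -big_split /=; case Irj: (I r j) => /=.
  apply/esym; rewrite add1n ltnS; apply: leq_sum => k _.
  case: (boolP (r < k < j)) => //= /andP[rk kj].
  case: (boolP (w j < w k)) => //= wjk.
  by have [_ /(_ Irj)] := bI _ _ _ rk kj; case: (I r k); case: (I k j).
apply/esym/negbTE; rewrite -leqNgt; apply: leq_sum => k _.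
have [kj|jk|/val_inj ->] := ltngtP k j; last by rewrite Irj !(andbF, ltnn).
  case: (ltnP r k) => /= rk; last first.
    case Irk: (I r k); rewrite ?andbF //; have := Iinv _ _ Irk; lia.
  have [+ _] := bI _ _ _ rk kj; rewrite Irj.
  case Ikj: (I k j); last by case: (w j < w k); case: (I r k).
  by have /andP[_ ->] := Iinv _ _ Ikj; case: (I r k) => // /(_ isT isT).
rewrite andbF /=; have [_] := bI _ _ _ rj jk; rewrite Irj.
case Irk: (I r k); rewrite ?andbF // => /(_ isT) /= /Iinv /andP[_ h].
by rewrite ltnNge (ltnW h).
Qed.

End HookBalanced.

(** * Removing a cell of [I] at a descent *)

Section RemoveDescent.
Variables (n : nat) (w : 'S_n) (I : rel 'I_n) (i i' : 'I_n).
Hypotheses (hi : i' = i.+1 :> nat) (Iinv : inversion_rel w I) (Ii : I i i').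

Let t := tperm i i'.

(** The guard [p < q] discards exactly the pair [(i, i')] of [I], which the exchange would send to
    [(i', i)]. *)
Definition swap_rel : rel 'I_n := fun p q => (p < q) && I (t p) (t q).

Let tE (p : 'I_n) : t p = (if p == i :> nat then i.+1
                  else if p == i.+1 :> nat then i else p) :> nat.
Proof. exact: val_tperm. Qed.

Let wi : w i' < w i. Proof. by have /andP[] := Iinv Ii. Qed.

Lemma swap_inversion_rel : inversion_rel (t * w)%g swap_rel.
Proof. by move=> p q /andP[-> /Iinv]; rewrite !permM /= => /andP[_ ->]. Qed.

(** Triples that do not contain both [i] and [i'] are merely relabelled. In the others [I i i']
    makes coclosedness trivial, and closedness is coclosedness of [swap_rel], which never holds at
    [(i, i')]. *)
Lemma swap_biclosed : biclosed swap_rel -> biclosed I.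
Proof.
have mono (p q : 'I_n) : p < q ->
    ~~ ((p == i :> nat) && (q == i' :> nat)) -> t p < t q.
  by move=> pq h; rewrite ltn_tperm //; lia.
move=> bI p q r pq qr.
have [/andP[/eqP/val_inj Ep /eqP/val_inj Eq]|h1] :=
  boolP ((p == i :> nat) && (q == i' :> nat)).
  subst p q; split=> [_ Ir|]; last by rewrite Ii.
  have [_] := bI i i' r pq qr; rewrite /swap_rel /t tpermL tpermR.
  rewrite tpermD ?(ltn_trans pq qr) ?pq ?qr; first 1 last.
  - by rewrite -val_eqE /=; lia.
  - by rewrite -val_eqE /=; lia.
  by move=> /(_ Ir) /= /orP[/Iinv|]//; lia.
have [/andP[/eqP/val_inj Eq /eqP/val_inj Er]|h2] :=
  boolP ((q == i :> nat) && (r == i' :> nat)).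
  subst q r; split=> [Ip _|]; last by rewrite Ii orbT.
  have [_] := bI p i i' pq qr; rewrite /swap_rel /t tpermL tpermR.
  rewrite tpermD ?(ltn_trans pq qr) ?pq ?qr; first 1 last.
  - by rewrite -val_eqE /=; lia.
  - by rewrite -val_eqE /=; lia.
  by move=> /(_ Ip) /= /orP[//|/Iinv]; lia.
have := bI (t p) (t q) (t r) (mono _ _ pq h1) (mono _ _ qr h2).
rewrite /swap_rel !tpermK !mono ?(ltn_trans pq qr) //.
apply/negP => /andP[/eqP Ep /eqP Er]; lia.
Qed.


Let reindex (F : 'I_n -> nat) : \sum_k F k = \sum_k F (t k).
Proof. exact: reindex_inj perm_inj. Qed.

Let leg_v (p q : 'I_n) : hook_leg (t * w)%g p q =
  \sum_(k : 'I_n) ((p < t k < q) && (w (t q) < w k)).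
Proof. by rewrite /hook_leg reindex; apply: eq_bigr => k _; rewrite !permM /t tpermK. Qed.

Let lc_v (p q : 'I_n) : leg_count swap_rel p q =
  \sum_(k : 'I_n) ((p < t k < q) && I k (t q)).
Proof.
rewrite /leg_count reindex; apply: eq_bigr => k _.
by rewrite /swap_rel /t tpermK; case: (tperm i i' k < q); rewrite ?andbF.
Qed.

Let ac_v (p q : 'I_n) : arm_count (t * w)%g swap_rel p q =
  \sum_(k : 'I_n) ((w (t q) < w k) && ((p < t k) && I (t p) k)).
Proof.
by rewrite /arm_count reindex; apply: eq_bigr => k _; rewrite /swap_rel !permM /t tpermK.
Qed.

Let I_lt (p q : 'I_n) : I p q -> p < q. Proof. by move/Iinv/andP=> []. Qed.

Let nI (p q : 'I_n) : q <= p -> I p q = false.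
Proof. by move=> h; apply/negP => /I_lt; rewrite ltnNge h. Qed.

Let nIw (p q : 'I_n) : w p <= w q -> I p q = false.
Proof. by move=> h; apply/negP => /Iinv /andP[_]; rewrite ltnNge h. Qed.

Let tL : t i = i'. Proof. exact: tpermL. Qed.
Let tR : t i' = i. Proof. exact: tpermR. Qed.
Let tD (p : 'I_n) : p != i :> nat -> p != i' :> nat -> t p = p.
Proof. by rewrite !val_eqE => h1 h2; rewrite /t tpermD 1?eq_sym. Qed.

Hypothesis bI : hook_balanced w I.

Let leg_ii' (q : 'I_n) : i' < q -> w q < w i' ->
  hook_leg w i q = (hook_leg w i' q).+1.
Proof.
move=> iq wq; rewrite /hook_leg (bigD1 i') //= [in RHS](bigD1 i') //=.
rewrite iq wq ltnn {1}hi ltnSn /= add0n add1n; congr _.+1; apply: eq_bigr => k.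
by rewrite -val_eqE /= hi => ki; congr (nat_of_bool (_ && _)); lia.
Qed.

Let lc_ii' (q : 'I_n) : i' < q ->
  leg_count I i q = I i' q + leg_count I i' q.
Proof.
move=> iq; rewrite /leg_count (bigD1 i') //= [in RHS](bigD1 i') //=.
rewrite iq ltnn {1}hi ltnSn /= add0n; congr (_ + _); apply: eq_bigr => k.
by rewrite -val_eqE /= hi => ki; congr (nat_of_bool (_ && _)); lia.
Qed.

(* A violation at [q] makes the hooks of [(i, w q)] and [(i', w q)] differ so
   much that there is another one at some [k] with [w q < w k]. *)
Let dominated (q : 'I_n) : i' < q -> I i' q -> I i q.
Proof.
move: {2}(n - w q) (leqnn (n - w q)) => m.
elim: m q => [|m IH] q hm iq Iq; first by have := ltn_ord (w q); lia.
have /andP[_ wq] := Iinv Iq.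
(* To the right of column [w q], row [i] contains [I] of row [i'] by induction; the cell [(i, w i')]
   makes the inequality strict. *)
have ac : arm_count w I i' q < arm_count w I i q.
  rewrite /arm_count (bigD1 i') //= [X in _ < X](bigD1 i') //=.
  rewrite Ii wq nI //= add0n add1n ltnS; apply: leq_sum => k _.
  case: (ltnP (w q) (w k)) => //= wk; case Ik: (I i' k) => //.
  by rewrite IH //; [lia | exact: I_lt].
have := bI iq wq; have := @bI i q (ltn_trans _ iq) (ltn_trans wq wi).
rewrite leg_ii' // lc_ii' // hi ltnSn => /(_ isT); rewrite Iq; case: (I i q); lia.
Qed.

(** Row [i'] of [w s_i] is row [i] of [w] without the cell [(i, w i')]; [dominated] compares it with
    row [i'] of [w]. *)
Let ac_ii' (q : 'I_n) : i' < q -> w q < w i' -> exists A,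
  [/\ arm_count w I i q = A.+1, arm_count w I i' q <= A
    & arm_count (t * w)%g swap_rel i' q = A].
Proof.
move=> iq wq; exists (arm_count w I i q).-1.
have E : arm_count w I i q = (\sum_(k < n | k != i') ((w q < w k) && I i k)).+1.
  by rewrite /arm_count (bigD1 i') //= Ii wq.
rewrite E /=; split=> //.
  rewrite /arm_count (bigD1 i') //= nI // andbF; apply: leq_sum => k _.
  case: (w q < w k) => //=; case Ik: (I i' k) => //.
  by rewrite dominated // I_lt.
rewrite ac_v tR tD; [|lia|lia].
rewrite (bigD1 i') //= tR (_ : (i' < i) = false); last lia.
rewrite andbF add0n; apply: eq_bigr => k.
rewrite -val_eqE /= hi => ki; congr (nat_of_bool (_ && _)).
rewrite tE (negbTE ki); case: eqP => [ki'|_]; first by rewrite nI ?ki' // andbF.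
by case Ik: (I i k); rewrite ?andbF // andbT; have := I_lt Ik; lia.
Qed.

Let ac_fix (p q : 'I_n) : p != i' :> nat ->
  arm_count (t * w)%g swap_rel p q = arm_count w I (t p) (t q).
Proof.
move=> pi; rewrite ac_v; apply: eq_bigr => k _; congr (nat_of_bool (_ && _)).
case Ik: (I (t p) k); rewrite ?andbF // andbT; move: (I_lt Ik).
by rewrite !tE; do ?case: ifP; move: pi; rewrite hi; lia.
Qed.

(** For corners outside the rows [i] and [i'] the counts agree, up to the cell [(i, w i')], which
    leaves the legs in column [w i'] and takes one element of [I] with it. For corners in these rows
    the leg or the arm may change by one cell, and [dominated] keeps the equivalence. *)
Lemma swap_hook_balanced : hook_balanced (t * w)%g swap_rel.
Proof.
move=> p q pq; rewrite !permM -/t => wqp; rewrite /swap_rel pq andTb.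
have [/val_inj Ep|pi] := eqVneq (p : nat) i.
  subst p; have [/val_inj Eq|qi'] := eqVneq (q : nat) i'.
    by subst q; move: wqp; rewrite tL tR ltnNge ltnW.
  move: wqp; rewrite ac_fix; last by rewrite hi; lia.
  rewrite leg_v lc_v tL tD //; last lia.
  (* The term [k = i] is row [i'] of [w s_i]: a leg cell that the hook of row [i'] of [w] lacks. *)
  move=> wq; rewrite (bigD1 i) //= [X in _ + X + _](bigD1 i) //= tL.
  have iq : i' < q by lia.
  rewrite iq hi ltnSn (ltn_trans wq wi) /=.
  rewrite (_ : \sum_(k < n | _) _ = hook_leg w i' q); last first.
    rewrite /hook_leg [RHS](bigD1 i) //= (_ : (i' < i) = false); last lia.
    rewrite add0n; apply: eq_bigr => k; rewrite -val_eqE /= => ki.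
    by rewrite tE; congr (nat_of_bool (_ && _)); do ?case: ifP; lia.
  rewrite (_ : \sum_(k < n | _) _ = leg_count I i' q); last first.
    rewrite /leg_count [RHS](bigD1 i) //= (_ : (i' < i) = false); last lia.
    rewrite add0n; apply: eq_bigr => k; rewrite -val_eqE /= => ki.
    by rewrite tE; congr (nat_of_bool (_ && _)); do ?case: ifP; lia.
  have := bI iq wq; have := dominated iq.
  by case: (I i' q); case: (I i q); move=> h; try (by have := h isT); lia.
have [/val_inj Ep|pi'] := eqVneq (p : nat) i'.
  subst p; move: wqp; rewrite tR (tD (p := q)); [|lia|lia] => wq.
  have -> : hook_leg (t * w)%g i' q = hook_leg w i' q.
    rewrite leg_v; apply: eq_bigr => k _; rewrite (tD (p := q)); [|lia|lia].
    by rewrite tE; congr (nat_of_bool (_ && _)); do ?case: ifP; lia.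
  have -> : leg_count swap_rel i' q = leg_count I i' q.
    rewrite lc_v; apply: eq_bigr => k _; rewrite (tD (p := q)); [|lia|lia].
    by rewrite tE; congr (nat_of_bool (_ && _)); do ?case: ifP; lia.
  have iq : i < q by rewrite (ltn_trans _ pq) // hi.
  have := bI iq wq; rewrite lc_ii' //.
  have [wq'|wq'] := ltnP (w q) (w i').
    have [A [-> hA ->]] := ac_ii' pq wq'; rewrite leg_ii' //.
    have := bI pq wq'; have := dominated pq.
    by case: (I i' q); case: (I i q); move=> h; try (by have := h isT); lia.
  rewrite (@nIw i' q) // => {1}->; congr (_ < _).
    rewrite /hook_leg (bigD1 i') //= [RHS](bigD1 i') //=.
    rewrite (_ : (w q < w i') = false) ?andbF; last lia.
    congr (_ + _); apply: eq_bigr => k; rewrite -val_eqE /= hi => ki.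
    by congr (nat_of_bool (_ && _)); lia.
  rewrite add0n; congr (_ + _); rewrite ac_v tR (tD (p := q)); [|lia|lia].
  rewrite /arm_count (bigD1 i') //= [RHS](bigD1 i') //=.
  rewrite (_ : (w q < w i') = false) /=; last lia.
  congr (_ + _); apply: eq_bigr => k; rewrite -val_eqE /= => ki.
  rewrite tE (negbTE (_ : k != i.+1 :> nat)); last by rewrite -hi.
  case: eqP => [ki'|_]; first by rewrite nI ?ki' // !andbF.
  by case Ik: (I i k); rewrite ?andbF // andbT; have := I_lt Ik; lia.
rewrite ac_fix // leg_v lc_v; move: wqp; rewrite (tD (p := p)) //.
have [/val_inj Eq|qi] := eqVneq (q : nat) i.
  subst q; rewrite tL => wq; have pi2 : p < i' by lia.
  (* The term [k = i] is the cell [(i, w i')], counted once in the leg and once in [I]; the two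
     cancel. *)
  rewrite [LHS](bI pi2 wq) /hook_leg /leg_count (bigD1 i) //=.
  rewrite [X in (_ < _ + X + _) = _](bigD1 i) //= pq hi ltnSn wi Ii /=.
  rewrite !add1n addnS addSn ltnS; congr (_ < _ + _ + _).
    rewrite [RHS](bigD1 i) //= tL (_ : (i' < i) = false); last lia.
    rewrite andbF add0n; apply: eq_bigr => k; rewrite -val_eqE /= => ki.
    by rewrite tE; congr (nat_of_bool (_ && _)); do ?case: ifP; lia.
  rewrite [RHS](bigD1 i) //= tL (_ : (i' < i) = false); last lia.
  rewrite andbF add0n; apply: eq_bigr => k; rewrite -val_eqE /= => ki.
  by rewrite tE; congr (nat_of_bool (_ && _)); do ?case: ifP; lia.
have [/val_inj Eq|qi'] := eqVneq (q : nat) i'.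
  subst q; rewrite tR => wq; have pi2 : p < i by lia.
  rewrite [LHS](bI pi2 wq) /hook_leg /leg_count; congr (_ < _ + _ + _).
    rewrite (bigD1 i') //= [RHS](bigD1 i') //= (_ : (w i < w i') = false); last lia.
    rewrite !andbF; congr (_ + _); apply: eq_bigr => k; rewrite -val_eqE /= => ki.
    by rewrite tE; congr (nat_of_bool (_ && _)); do ?case: ifP; lia.
  rewrite (bigD1 i') //= [RHS](bigD1 i') //= (@nI i' i); last lia.
  rewrite !andbF; congr (_ + _); apply: eq_bigr => k; rewrite -val_eqE /= => ki.
  by rewrite tE; congr (nat_of_bool (_ && _)); do ?case: ifP; lia.
rewrite (tD (p := q)) // => wq; rewrite [LHS](bI pq wq) /hook_leg /leg_count.
congr (_ < _ + _ + _); apply: eq_bigr => k _;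
  by rewrite tE; congr (nat_of_bool (_ && _)); do ?case: ifP; lia.
Qed.

End RemoveDescent.

(* The lowest row meeting [I] contains a cell of [I] at a descent: in this row,
   the cell of [I] of largest column has an empty leg. *)
Lemma hook_balanced_descent n (w : 'S_n) (I : rel 'I_n) (p q : 'I_n) :
    inversion_rel w I -> hook_balanced w I -> I p q ->
  exists i i' : 'I_n, i' = i.+1 :> nat /\ I i i'.
Proof.
move=> Iinv bI; move: {2}(n - p) (leqnn (n - p)) => m.
elim: m p q => [|m IH] p q hm Ipq; first by have := ltn_ord p; lia.
have [/existsP[k /existsP[l /andP[pk Ikl]]]|low] :=
  boolP [exists k : 'I_n, exists l, (p < k) && I k l].
  by apply: (IH k l) => //; lia.
have {IH} low (k l : 'I_n) : p < k -> I k l = false.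
  move=> pk; apply/negbTE; apply: contraNN low => Ikl.
  by apply/existsP; exists k; apply/existsP; exists l; rewrite pk.
have [{Ipq}j Ipj jmax] := arg_maxnP (fun j => w j) (Ipq : [pred j | I p j] q).
rewrite /= in Ipj jmax.
have /andP[pj wj] := Iinv _ _ Ipj.
have noleg (k : 'I_n) : p < k -> k < j -> w k < w j.
  move=> pk kj; have := bI _ _ pj wj; rewrite /leg_count big1; last first.
    by move=> l _; case: (ltnP p l) => //= pl; rewrite low ?andbF.
  rewrite /arm_count big1 => [|l _]; last first.
    case: (ltnP (w j) (w l)) => //= wl; case Ipl: (I p l) => //.
    by have := jmax l Ipl; rewrite leqNgt wl.
  rewrite Ipj /= !addn0 ltnS leqn0 => /esym/eqP/eqP.
  rewrite sum_nat_eq0 => /forallP /(_ k) /=; rewrite pk kj /= eqb0 -leqNgt.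
  rewrite leq_eqVlt => /orP[/eqP/val_inj/perm_inj E|//].
  by move: kj; rewrite E ltnn.
have hp : p.+1 < n by apply: leq_ltn_trans (ltn_ord j).
exists p, (Ordinal hp); split=> //; set p' := Ordinal hp.
have [E|pj'] := eqVneq (j : nat) p'; first by rewrite -(val_inj E).
have jp' : p' < j.
  by rewrite ltn_neqAle [_ == _]eq_sym pj'.
have wp' : w p' < w j by exact: noleg.
(* The leg of [(p, w p')] is empty as [p] and [p'] are adjacent, and its arm contains [(p, w j)], so
   the hook condition forces [I p p']. *)
rewrite bI ?(ltn_trans wp' wj) //= /hook_leg big1 => [|k _]; last first.
  by rewrite ltnS; case: ltnP => //=; lia.
by rewrite /arm_count (bigD1 j) //= wp' Ipj; lia.
Qed.

Lemma hook_balanced_biclosed n (w : 'S_n) (I : rel 'I_n) :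
  inversion_rel w I -> hook_balanced w I -> biclosed I.
Proof.
move E: #|inv_pairs w| => m; elim: m w I E => [|m IH] w I E Iinv bI.
  have I0 p q : I p q = false.
    apply/negP => /Iinv h; have /eqP := E; rewrite cards_eq0 => /eqP E0.
    have : (p, q) \in inv_pairs w by rewrite inE.
    by rewrite E0 inE.
  by move=> p q r _ _; rewrite !I0.
case: (boolP [exists p, exists q, I p q]) => [/existsP[p /existsP[q Ipq]]|I0].
  have [i [i' [hi Ii]]] := hook_balanced_descent Iinv bI Ipq.
  apply: (swap_biclosed hi Iinv Ii); have /andP[_ wi] := Iinv _ _ Ii.
  apply: (IH (tperm i i' * w)%g).
  - by apply/eq_add_S; rewrite -card_inv_pairs_tperm_desc.
  - exact: swap_inversion_rel.
  - exact: swap_hook_balanced.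
have {}I0 p q : I p q = false.
  apply/negbTE; apply: contraNN I0 => h.
  by apply/existsP; exists p; apply/existsP; exists q.
by move=> p q r _ _; rewrite !I0.
Qed.

(** * Balanced labellings *)

(** In a decreasing list the entries that are at least [t] form a prefix, whose length is their
    number. *)
Lemma geq_nth_sort (s : seq nat) t i : i < size s ->
  (t <= nth 0 (sort geq s) i) = (i < count (leq t) s).
Proof.
rewrite -(size_sort geq) -(count_sort geq).
have : sorted geq (sort geq s) by apply: sort_sorted => x y; apply: leq_total.
elim: (sort geq s) i => // x u IH i xu /=.
have xall : all (geq x) u.
  by apply: order_path_min xu => a b c /= ba ac; apply: leq_trans ac ba.
case: i => [_|i]; rewrite ?ltnS /=.
  case: (leqP t x) => //= xt; apply/esym/negbTE.
  rewrite -eqn0Ngt -leqn0 leqNgt -has_count.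
  apply/hasPn => y /(allP xall) /= yx; rewrite -ltnNge; exact: leq_ltn_trans yx xt.
move=> iu; case: (leqP t x) => [tx|xt]; first by rewrite ltnS IH ?(path_sorted xu).
rewrite add0n IH ?(path_sorted xu) //.
suff -> : count (leq t) u = 0 by [].
apply/eqP; rewrite -leqn0 leqNgt -has_count; apply/hasPn => y /(allP xall) /= yx.
by rewrite -ltnNge; apply: leq_ltn_trans yx xt.
Qed.

Lemma count_enum_ord n (P : pred 'I_n) : count P (enum 'I_n) = \sum_k P k.
Proof.
by rewrite -sum1_count big_mkcond big_enum; apply: eq_bigr => k _; case: (P k).
Qed.

Definition on_rothe n (w : 'S_n) (B : labelling n) : Prop :=
  forall x, (0 < B x) = (x \in rothe w).

Definition level_rel n (w : 'S_n) (B : labelling n) (t : nat) : rel 'I_n :=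
  fun p q => (p < q) && (t <= B (p, w q)).

(** Biclosedness at all thresholds at once: closedness is the lower bound, coclosedness the upper
    one. *)
Definition triple_balanced n (w : 'S_n) (B : labelling n) : Prop :=
  forall p q r : 'I_n, p < q -> q < r ->
    minn (B (p, w q)) (B (q, w r)) <= B (p, w r)
      <= maxn (B (p, w q)) (B (q, w r)).

Section Labelling.
Variables (n : nat) (w : 'S_n) (B : labelling n).
Hypothesis Bw : on_rothe w B.

Lemma on_rotheE (p q : 'I_n) : (0 < B (p, w q)) = (p < q) && (w q < w p).
Proof. by rewrite Bw mem_rothe. Qed.

Lemma level_inversion_rel t : 0 < t -> inversion_rel w (level_rel w B t).
Proof. by move=> t0 p q /andP[_ /(leq_trans t0)]; rewrite on_rotheE. Qed.

Lemma size_leg (r j : 'I_n) : size (leg w (r, w j)) = hook_leg w r j.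
Proof.
rewrite size_map size_filter count_rev count_enum_ord; apply: eq_bigr => k _.
by rewrite mem_rothe /= andbA.
Qed.

Lemma count_hook (r j : 'I_n) t : 0 < t -> r < j ->
  count (leq t) (map B (hook w (r, w j))) =
  level_rel w B t r j + leg_count (level_rel w B t) r j
    + arm_count w (level_rel w B t) r j.
Proof.
move=> t0 rj; rewrite /hook map_cat count_cat /= -!map_comp !count_map 2!count_filter.
rewrite addnCA addnA; congr (_ + _ + _); first by rewrite /level_rel rj.
  rewrite count_rev count_enum_ord; apply: eq_bigr => k _ /=.
  rewrite mem_rothe /level_rel.
  case: (leqP t (B (k, w j))) => /= [tB|]; last by rewrite !andbF.
  have := leq_trans t0 tB; rewrite on_rotheE => /andP[-> ->].
  by rewrite !andbT.
rewrite count_enum_ord (reindex_inj (@perm_inj _ w)); apply: eq_bigr => k _ /=.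
rewrite mem_rothe /level_rel.
case: (leqP t (B (r, w k))) => /= [tB|]; last by rewrite !andbF.
have := leq_trans t0 tB; rewrite on_rotheE => /andP[-> ->].
by rewrite !andbT.
Qed.

Lemma balanced_hook_balanced :
  balanced w B <-> forall t, 0 < t -> hook_balanced w (level_rel w B t).
Proof.
have lt_size r j : size (leg w (r, w j)) < size (map B (hook w (r, w j))).
  by rewrite size_map size_cat /= addnS ltnS leq_addr.
split=> [bB t t0 r j rj wj|bB [r c]].
  rewrite -size_leg -count_hook // -geq_nth_sort // bB ?mem_rothe ?rj //.
  by rewrite /level_rel rj.
rewrite -(permKV w c); set j := (w^-1)%g c; rewrite mem_rothe => /andP[rj wj].
have E t : 0 < t ->
    (t <= nth 0 (sort geq (map B (hook w (r, w j)))) (size (leg w (r, w j)))) =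
    (t <= B (r, w j)).
  by move=> t0; rewrite geq_nth_sort // count_hook // size_leg -bB // /level_rel rj.
set x := nth _ _ _ in E *; apply/eqP; rewrite eqn_leq.
(* [E] is available for positive thresholds only, so zero values are treated apart. *)
case: (posnP x) => [x0|/E <-]; last rewrite leqnn /=.
  by case: (posnP (B (r, w j))) => [->|/E]; rewrite x0 ?leqnn // => <-.
by case: (posnP (B (r, w j))) => [->//|/E ->].
Qed.

Lemma balancedP : balanced w B <-> triple_balanced w B.
Proof.
rewrite balanced_hook_balanced; split=> [bB p q r pq qr|bB t t0]; last first.
  apply: biclosed_hook_balanced; first exact: level_inversion_rel.
  move=> p q r pq qr; rewrite /level_rel pq qr (ltn_trans pq qr) /=.
  have := bB p q r pq qr.
  move: (B (p, w q)) (B (q, w r)) (B (p, w r)) => x y z.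
  by rewrite geq_min leq_max; split; lia.
have bI t : 0 < t -> biclosed (level_rel w B t).
  move=> t0; apply: hook_balanced_biclosed (bB t t0).
  exact: level_inversion_rel.
apply/andP; split.
  (* Each bound uses the threshold equal to its own left-hand side; a zero one needs no proof. *)
  case: (posnP (minn (B (p, w q)) (B (q, w r)))) => [->//|/bI/(_ _ _ _ pq qr)[+ _]].
  by rewrite /level_rel pq qr (ltn_trans pq qr) /= geq_minl geq_minr => ->.
case: (posnP (B (p, w r))) => [->//|/bI/(_ _ _ _ pq qr)[_]].
by rewrite /level_rel pq qr (ltn_trans pq qr) /= leqnn leq_max => ->.
Qed.

End Labelling.

Lemma BLP n (w : 'S_n) (B : labelling n) :
  BL w B <-> on_rothe w B /\ triple_balanced w B.
Proof.
split=> [[h1 h2]|[h1 h2]]; split=> //; first exact/(balancedP h1).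
exact/(balancedP h1).
Qed.

(* For a descent [i] of [w] and [v = w s_i], the diagram of [w] is obtained
   from that of [v] by exchanging the rows [i] and [i'] and adding the cell
   [(i, w i')]. *)
Definition add_cell n (w : 'S_n) (i i' : 'I_n) M (B : labelling n) : labelling n :=
  [ffun x => if x == (i, w i') then M else B (tperm i i' x.1, x.2)].

(** The exchange of rows would move the label of [(i, w i')] to [(i', w i')], hence the zero
    there. *)
Definition del_cell n (w : 'S_n) (i i' : 'I_n) (B : labelling n) : labelling n :=
  [ffun x => if x == (i', w i') then 0 else B (tperm i i' x.1, x.2)].

Lemma del_cellK n (w : 'S_n) (i i' : 'I_n) (B : labelling n) :
  add_cell w i i' (B (i, w i')) (del_cell w i i' B) = B.
Proof.
apply/ffunP => -[p c]; rewrite !ffunE /=; case: eqP => [[-> ->]//|ne].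
rewrite tpermK; case: eqP => // -[E ?]; subst c; case: ne.
by rewrite -(tpermK i i' p) E tpermR.
Qed.

Section Cells.
Variables (n : nat) (w : 'S_n) (i i' : 'I_n).
Hypotheses (hi : i' = i.+1 :> nat) (wi : w i' < w i).
Let t := tperm i i'.

Lemma mem_rothe_tperm (p c : 'I_n) : (p, c) != (i, w i') ->
  ((t p, c) \in rothe (t * w)%g) = ((p, c) \in rothe w).
Proof.
rewrite -(permKV w c); set q := (w^-1)%g c; rewrite xpair_eqE (inj_eq perm_inj).
move=> ne; rewrite (mem_rothe w) -{1}[w q](_ : (t * w)%g (t q) = w q); last first.
  by rewrite permM /t tpermK.
rewrite mem_rothe !permM /t !tpermK.
have [/andP[/eqP -> /eqP ->]|h] := boolP ((p == i') && (q == i)).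
  by rewrite tpermL tpermR; lia.
by rewrite ltn_tperm // ?val_eqE.
Qed.

Lemma notin_rothe_tperm : (i', w i') \notin rothe (t * w)%g.
Proof.
rewrite -[w i'](_ : (t * w)%g i = w i'); last by rewrite permM /t tpermL.
by rewrite mem_rothe negb_and -leqNgt hi leqnSn.
Qed.

Lemma mem_rothe_desc : (i, w i') \in rothe w.
Proof. by rewrite mem_rothe hi ltnSn wi. Qed.

Lemma add_cell_on_rothe M (B : labelling n) : 0 < M ->
  on_rothe (t * w)%g B -> on_rothe w (add_cell w i i' M B).
Proof.
move=> M0 Bv [p c]; rewrite ffunE; case: eqVneq => [->|ne].
  by rewrite M0 mem_rothe_desc.
by rewrite Bv mem_rothe_tperm.
Qed.

Lemma del_cell_on_rothe (B : labelling n) :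
  on_rothe w B -> on_rothe (t * w)%g (del_cell w i i' B).
Proof.
move=> Bw [p c]; rewrite ffunE; case: eqVneq => [->|ne].
  by rewrite (negbTE notin_rothe_tperm).
rewrite Bw -mem_rothe_tperm ?tpermK //; apply: contra_neq ne => -[E ->].
by rewrite -(tpermK i i' p) E tpermL.
Qed.

Lemma add_cellE M (B : labelling n) (p q : 'I_n) :
  ~~ ((p == i :> nat) && (q == i' :> nat)) ->
  add_cell w i i' M B (p, w q) = B (t p, w q).
Proof. by rewrite ffunE xpair_eqE (inj_eq perm_inj) -!val_eqE => /negbTE ->. Qed.

(** Only triples through both [i] and [i'] are not relabelled. In these, [M] bounds all labels, so a
    label [M] before the exchange and an empty cell after it impose the same inequality on the two
    other labels, whose roles are exchanged. *)
Lemma triple_balanced_add_cell M (B : labelling n) :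
    on_rothe (t * w)%g B -> (forall x, B x <= M) ->
  triple_balanced w (add_cell w i i' M B) <-> triple_balanced (t * w)%g B.
Proof.
move=> Bv BM.
have AE (p q : 'I_n) : ~~ ((p == i :> nat) && (q == i' :> nat)) ->
    add_cell w i i' M B (p, w q) = B (t p, (t * w)%g (t q)).
  by move=> h; rewrite add_cellE // permM /t tpermK.
have e1 a b : (minn M (B a) <= B b <= maxn M (B a)) =
    (minn 0 (B b) <= B a <= maxn 0 (B b)).
  by move: (BM a) (BM b); move: (B a) (B b) => x y; lia.
have e2 a b : (minn (B a) M <= B b <= maxn (B a) M) =
    (minn (B b) 0 <= B a <= maxn (B b) 0).
  by move: (BM a) (BM b); move: (B a) (B b) => x y; lia.
have Bii : B (i, (t * w)%g i') = 0.
  apply/eqP; rewrite -leqn0 leqNgt Bv mem_rothe !permM /t tpermL tpermR hi.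
  by rewrite ltnSn ltnNge ltnW.
have AM : add_cell w i i' M B (i, w i') = M by rewrite ffunE eqxx.
have tlt (p q : 'I_n) : ~~ ((p == i :> nat) && (q == i' :> nat)) ->
    p < q -> t p < t q.
  by move=> h pq; rewrite ltn_tperm //; lia.
have tne (p q : 'I_n) : p < q -> ~~ ((t p == i :> nat) && (t q == i' :> nat)).
  by move=> pq; rewrite !val_tperm // hi; do ?case: ifP; lia.
have tD (p : 'I_n) : p != i :> nat -> p != i' :> nat -> t p = p.
  by rewrite !val_eqE => h1 h2; rewrite /t tpermD 1?eq_sym.
have tL : t i = i' by exact: tpermL.
have tR : t i' = i by exact: tpermR.
split=> tB p q r pq qr; have pr := ltn_trans pq qr.
  have [/andP[/eqP/val_inj Ep /eqP/val_inj Eq]|h1] :=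
    boolP ((p == i :> nat) && (q == i' :> nat)).
    subst p q; have := tB i i' r pq qr.
    rewrite AM !AE; [|lia|lia]; rewrite tL tR (tD r); [|lia|lia].
    by rewrite Bii e1.
  have [/andP[/eqP/val_inj Eq /eqP/val_inj Er]|h2] :=
    boolP ((q == i :> nat) && (r == i' :> nat)).
    subst q r; have := tB p i i' pq qr.
    rewrite AM !AE; [|lia|lia]; rewrite tL tR (tD p); [|lia|lia].
    by rewrite Bii e2.
  have := tB (t p) (t q) (t r) (tlt _ _ h1 pq) (tlt _ _ h2 qr).
  by rewrite !AE ?tne // /t !tpermK.
have [/andP[/eqP/val_inj Ep /eqP/val_inj Eq]|h1] :=
  boolP ((p == i :> nat) && (q == i' :> nat)).
  subst p q; have := tB i i' r pq qr.
  rewrite AM !AE; [|lia|lia]; rewrite tL tR (tD r); [|lia|lia].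
  by rewrite Bii e1.
have [/andP[/eqP/val_inj Eq /eqP/val_inj Er]|h2] :=
  boolP ((q == i :> nat) && (r == i' :> nat)).
  subst q r; have := tB p i i' pq qr.
  rewrite AM !AE; [|lia|lia]; rewrite tL tR (tD p); [|lia|lia].
  by rewrite Bii e2.
have := tB (t p) (t q) (t r) (tlt _ _ h1 pq) (tlt _ _ h2 qr).
rewrite !AE //; lia.
Qed.

Lemma BL_add_cell M (B : labelling n) : 0 < M -> (forall x, B x <= M) ->
  BL (t * w)%g B -> BL w (add_cell w i i' M B).
Proof.
move=> M0 BM /BLP[h1 h2]; apply/BLP; split; first exact: add_cell_on_rothe.
exact/triple_balanced_add_cell.
Qed.

Lemma BL_del_cell (B : labelling n) : (forall x, B x <= B (i, w i')) ->
  BL w B -> BL (t * w)%g (del_cell w i i' B).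
Proof.
move=> BM /BLP[h1 h2]; apply/BLP; have h := del_cell_on_rothe h1; split=> //.
apply/(triple_balanced_add_cell (M := B (i, w i'))) => //.
  by move=> x; rewrite ffunE; case: ifP.
by rewrite del_cellK.
Qed.

End Cells.

(* A maximal label at the positions [(r, j)] is also found at [(r, q)] or at
   [(q, j)] for any [q] in between, hence finally at adjacent positions. *)
Lemma max_label_desc n (w : 'S_n) (B : labelling n) M (r j : 'I_n) :
    BL w B -> (forall x, B x <= M) -> r < j -> B (r, w j) = M ->
  exists i i' : 'I_n, [/\ i' = i.+1 :> nat, r <= i, i' <= j & B (i, w i') = M].
Proof.
move=> /BLP[_ tB] BM; case: j => j hj; elim: j hj => // j IH hj; rewrite ltnS => rj BrM.
have hj' := ltnW hj; move: rj; rewrite leq_eqVlt => /orP[/eqP E|rj].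
  by exists r, (Ordinal hj); rewrite /= E; split=> //; lia.
have /andP[_] := tB r (Ordinal hj') (Ordinal hj) rj (ltnSn _).
rewrite BrM leq_max => /orP[h|h].
  have [] := IH hj' rj; first by apply/eqP; rewrite eqn_leq BM.
  by move=> i [i' [h1 h2 h3 h4]]; exists i, i'; split=> //=; apply: leqW.
by exists (Ordinal hj'), (Ordinal hj); split=> //=; [exact: ltnW | apply/eqP; rewrite eqn_leq BM].
Qed.

(** * Sliding *)

Lemma leftmost_small D p d : d < p -> leftmost D p d = None.
Proof.
move=> dp; case E: leftmost => [i|//]; have /andP[pi /andP[id _]] := leftmostP E.
by have := leq_trans pi id; rewrite leqNgt dp.
Qed.

Lemma leftmost_cons D p d : 0 < p ->
  leftmost D p d = if meets D d p then Some p else leftmost D p.+1 d.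
Proof.
move=> p0; rewrite /leftmost; case sD: (size D) => [|s].
  by rewrite /meets /has_cell (size0nil sD) nth_nil ltn0 !andbF.
rewrite (_ : iota p.+1 s.+1 = iota p.+1 s ++ [:: p.+1 + s]); last first.
  by rewrite -[s.+1]addn1 iotaD.
rewrite filter_cat /=; case: ifP => [//|_].
suff -> : meets D d (p.+1 + s) = false by rewrite cats0.
by apply/negP => /andP[_ /has_cell_size]; rewrite sD; lia.
Qed.

(** The rules restated as a scan of single towers: one that misses the diagonal is skipped with the
    letter unchanged. Here [k + p] is the diagonal of the free place on top of tower [p]. *)
Lemma slide_fromS D p a : 0 < p <= a ->
  slide_from D p a =
    let k := nth 0 D p.-1 in
    if k + p < a then slide_from D p.+1 a
    else if k + p == a then Some (p, k)
    else if k + p == a.+1 then None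
    else slide_from D p.+1 a.+1.
Proof.
case/andP=> p0 pa; rewrite /=; set k := nth 0 D p.-1.
have hc j : has_cell D p j = (j < k) by rewrite /has_cell p0.
rewrite slide_fromE ?p0 ?pa // (leftmost_cons D a.-1) // (leftmost_cons D a) //.
rewrite /meets !hc pa /=; move: pa; rewrite leq_eqVlt => /orP[/eqP pa|pa].
  (* For [p = a] no remaining tower can meet the diagonal [a - 1], which is rule (S1). *)
  rewrite -pa subnn (_ : p <= p.-1 = false) /=; last lia.
  rewrite leftmost_small; last lia.
  rewrite (_ : k + p < p = false); last lia.
  rewrite leftmost_small ?leqnn // hc.
  case: posnP => [->|k0]; first by rewrite add0n eqxx.
  rewrite (_ : k + p == p = false); last lia.
  by rewrite -leqNgt; case: ifP; case: ifP => //; lia.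
rewrite (_ : p <= a.-1) /=; last lia.
rewrite (_ : (a.-1 - p < k) = ~~ (k + p < a)); last lia.
case: (ltnP (k + p) a) => h /=.
  rewrite (_ : (a - p < k) = false) /=; last lia.
  by rewrite [RHS]slide_fromE.
rewrite hc (_ : (a - p < k) = (a < k + p)); last lia.
case: (ltngtP a (k + p)) h => //= [h _|-> _]; last by rewrite addnK.
by rewrite hc; case: (ltnP (a - p).+1 k) => hk /=; case: eqP => //; lia.
Qed.

Lemma slide_from_top D p a c : 0 < p <= a -> slide_from D p a = Some c ->
  [/\ p <= c.1, c.2 = nth 0 D c.1.-1 & a <= c.1 + c.2].
Proof.
(* Beyond the last tower the letter still moves through empty towers, hence the summand [a - p] of
   the measure. *)
move: {2}(_ + _) (leqnn ((size D).+1 - p + (a - p))) => m.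
elim: m p a => [|m IH] p a; rewrite ?leqn0 => hm pa.
  have pD : size D <= p.-1 by lia.
  rewrite slide_fromS //= nth_default // add0n (_ : p < a = false); last lia.
  rewrite (_ : p == a); last lia.
  by move=> [<-] /=; rewrite nth_default //; split=> //; lia.
rewrite slide_fromS //=; set k := nth 0 D p.-1.
have kp : 0 < k -> p <= size D.
  rewrite /k; case: (ltnP p.-1 (size D)) => h; last by rewrite nth_default.
  lia.
case: ifP => [h /IH|h]; first by case; [lia|lia|split=> //; lia].
case: eqP => [h1 [<-] /=|_]; first by split=> //; rewrite -/k; lia.
case: eqP => // h2 /IH; case; [lia|lia|split=> //; lia].
Qed.

Lemma slide_top D a c : slide D a = Some c -> 0 < a ->
  0 < c.1 /\ c.2 = nth 0 D c.1.-1.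
Proof. by move=> h a0; have [|? ? _] := slide_from_top _ h. Qed.

(** A tower lets the letters beyond [k + p] pass unchanged and raises by 1 those below [k + p - 1].
    The resulting ranges are disjoint, so the letter can be recovered after each tower. *)
Lemma slide_from_inj D p a b c : 0 < p <= a -> p <= b ->
  slide_from D p a = Some c -> slide_from D p b = Some c -> a = b.
Proof.
move: {2}(c.1 - p) (leqnn (c.1 - p)) => m.
elim: m p a b => [|m IH] p a b hm pa pb Ha Hb; have pb' : 0 < p <= b by lia.
  have [h1 _ _] := slide_from_top pa Ha.
  move: Ha Hb; rewrite (slide_fromS _ pa) (slide_fromS _ pb') /=; set k := nth 0 D p.-1.
  have no b' : p.+1 <= b' -> slide_from D p.+1 b' = Some c -> False.
    by move=> pb2 /slide_from_top[|h3 _ _]; move: pa; lia.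
  case: ifP => [h /no|_]; first lia.
  case: eqP => [<- _|_]; last by case: eqP => // h2 /no; lia.
  case: ifP => [h /no|_]; first lia.
  by case: eqP => [<- //|_]; last by case: eqP => // h2 /no; lia.
move: Ha Hb; rewrite (slide_fromS _ pa) (slide_fromS _ pb') /=; set k := nth 0 D p.-1.
have no b' : p.+1 <= b' -> slide_from D p.+1 b' = Some (p, k) -> False.
  by move=> pb2 /slide_from_top[|/= h3 _ _]; move: pa; lia.
case: ifP => h.
  move=> Ha; case: ifP => h'; first by apply: IH Ha; lia.
  case: eqP => [_ [E]|h4]; first by move: Ha; rewrite -E => /no; lia.
  case: eqP => // h2 Hb; suff : a = b.+1 by lia.
  by apply: IH Ha Hb; lia.
case: eqP => [<- [E]|h1].
  rewrite -E; case: ifP => [h' /no|_]; first lia.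
  by case: eqP => [<- //|_]; case: eqP => // h2 /no; lia.
case: eqP => // h2 Ha; case: ifP => h'.
  move=> Hb; suff : a.+1 = b by lia.
  by apply: IH Ha Hb; lia.
case: eqP => [_ [E]|h4]; first by move: Ha; rewrite -E => /no; lia.
case: eqP => // h3 Hb; suff : a.+1 = b.+1 by lia.
by apply: IH Ha Hb; lia.
Qed.

(** * The path of a letter along the code of a permutation *)

Section Walk.
Variables (W P : nat -> nat).
Hypotheses (WK : cancel W P) (PK : cancel P W).

Definition larger_before (x f : nat) : nat := count (fun k => x <= W k) (iota 0 f).

Lemma larger_beforeSr x f :
  larger_before x f.+1 = larger_before x f + (x <= W f).
Proof.
rewrite /larger_before (_ : iota 0 f.+1 = iota 0 f ++ [:: f]).
  by rewrite count_cat /= addn0.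
by rewrite -addn1 iotaD.
Qed.

Lemma larger_beforeS x f :
  larger_before x f = larger_before x.+1 f + (P x < f).
Proof.
elim: f => [|f IH]; first by rewrite ltn0.
rewrite !larger_beforeSr IH ltnS.
have : (x == W f) = (P x == f) by apply/eqP/eqP => [->|<-]; rewrite ?WK ?PK.
by case: ltngtP; case: ltngtP; rewrite ?ltnS //=; lia.
Qed.

Lemma leq_larger_before x f g : f <= g -> larger_before x f <= larger_before x g.
Proof.
by move=> fg; rewrite /larger_before -(subnKC fg) iotaD count_cat leq_addr.
Qed.

Lemma larger_before_ltn x f g : f < g -> x <= W f ->
  larger_before x f < larger_before x g.
Proof.
move=> fg xf; apply: leq_trans (leq_larger_before x fg).
by rewrite larger_beforeSr xf addn1.
Qed.

(* [D] agrees with the code of the permutation [W] on the towers below the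
   smallest of the entries at positions [f] and [f.+1]; a letter sliding past
   these towers is recorded by the number of larger entries before [f]. *)
Lemma slide_walk D f x :
    (forall z, z < x -> nth 0 D z = larger_before z.+1 (P z)) ->
    x <= W f -> x <= W f.+1 ->
  slide D f.+1 = slide_from D x.+1 (x + larger_before x f).+1.
Proof.
elim: x => [|x IH] hD xf xf1.
  rewrite add0n /slide; congr (slide_from _ _ _.+1).
  by rewrite /larger_before (eq_count (a2 := predT)) // count_predT size_iota.
rewrite IH ?(ltnW xf) ?(ltnW xf1) //; last by move=> z zx; apply: hD; apply: ltnW.
rewrite slide_fromS; last by rewrite /= ltnS leq_addr.
rewrite /= hD // (larger_beforeS x f).
have Pf : P x != f by apply: contraTneq xf => <-; rewrite PK ltnn.
have Pf1 : P x != f.+1 by apply: contraTneq xf1 => <-; rewrite PK ltnn.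
(* If [x] stands before position [f], its tower is too short to be met. Otherwise [W f] and [W f.+1]
   both count in its size, which makes it tall enough to raise the letter. *)
case: (ltnP (P x) f) => h /=.
  have hL := leq_larger_before x.+1 (ltnW h).
  rewrite ifT; last lia.
  by congr slide_from; lia.
have h1 := @larger_before_ltn x.+1 f f.+1 (ltnSn f) xf.
have h2 := @larger_before_ltn x.+1 f.+1 (P x) _ xf1.
have {}h2 : larger_before x.+1 f.+1 < larger_before x.+1 (P x) by apply: h2; lia.
by rewrite ifF ?ifF ?ifF; [congr slide_from; lia|lia|lia|lia].
Qed.

End Walk.

(** * Corners of the tower diagram of a permutation *)

(* Extended by the identity, so that letters need not be bounded. *)
Definition perm_nat n (w : 'S_n) (k : nat) : nat :=
  if insub k is Some i then w i : nat else k.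

Lemma perm_nat_ord n (w : 'S_n) (i : 'I_n) : perm_nat w i = w i.
Proof. by rewrite /perm_nat valK. Qed.

Lemma perm_nat_geq n (w : 'S_n) k : n <= k -> perm_nat w k = k.
Proof. by move=> nk; rewrite /perm_nat insubN // -leqNgt. Qed.

Lemma perm_natK n (w : 'S_n) : cancel (perm_nat w) (perm_nat w^-1%g).
Proof.
move=> k; case: (ltnP k n) => h; last by rewrite !perm_nat_geq.
by rewrite (perm_nat_ord w (Ordinal h)) perm_nat_ord permK.
Qed.

Lemma perm_natVK n (w : 'S_n) : cancel (perm_nat w^-1%g) (perm_nat w).
Proof. by have := perm_natK w^-1%g; rewrite invgK. Qed.

(** The Lehmer code of the inverse of [w], which turns out to be its tower diagram. *)
Definition code n (w : 'S_n) : diagram :=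
  [seq count (fun r => (r, c) \in rothe w) (enum 'I_n) | c <- enum 'I_n].

Lemma size_code n (w : 'S_n) : size (code w) = n.
Proof. by rewrite size_map size_enum_ord. Qed.

Lemma nth_code_count n (w : 'S_n) (c : 'I_n) :
  nth 0 (code w) c = count (fun r => (r, c) \in rothe w) (enum 'I_n).
Proof. by rewrite (nth_map c) ?size_enum_ord // nth_ord_enum. Qed.

Lemma nth_code n (w : 'S_n) x : x < n ->
  nth 0 (code w) x = larger_before (perm_nat w) x.+1 (perm_nat w^-1%g x).
Proof.
move=> xn; rewrite (nth_code_count w (Ordinal xn)) /larger_before.
rewrite (perm_nat_ord _ (Ordinal xn)); set f := (w^-1)%g _.
rewrite (eq_count (a2 := preim val (fun k => (k < f) && (x < perm_nat w k)))); last first.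
  by move=> r; rewrite mem_rotheV /= perm_nat_ord.
rewrite -count_map val_enum_ord.
rewrite (_ : iota 0 n = iota 0 f ++ iota f (n - f)); last first.
  by rewrite -{2}[f : nat]add0n -iotaD subnKC // ltnW.
rewrite count_cat.
rewrite [X in _ + X](_ : _ = 0) ?addn0; last first.
  apply/eqP; rewrite -leqn0 leqNgt -has_count; apply/hasPn => k.
  by rewrite mem_iota => /andP[fk _]; rewrite ltnNge fk.
by apply: eq_in_count => k; rewrite mem_iota add0n => /andP[_ ->].
Qed.

Lemma nth_remove_cell D c z :
  nth 0 (remove_cell D c) z = if z == c.1.-1 then c.2 else nth 0 D z.
Proof. by rewrite nth_set_nth. Qed.

Section Corners.
Variables (n : nat) (w : 'S_n).
Let W := perm_nat w.
Let P := perm_nat w^-1%g.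
Let L := larger_before W.

(** The tower after the walk is left arbitrary, as a flight number is tested on a diagram that
    differs from the code in one tower. *)
Lemma slide_walk_code D f x : (forall z, z < x -> nth 0 D z = nth 0 (code w) z) ->
    x < n -> x <= W f -> x <= W f.+1 ->
  slide D f.+1 =
    let k := nth 0 D x in let a := (x + (L x.+1 f + (P x < f))).+1 in
    if k + x.+1 < a then slide_from D x.+2 a
    else if k + x.+1 == a then Some (x.+1, k)
    else if k + x.+1 == a.+1 then None
    else slide_from D x.+2 a.+1.
Proof.
move=> hD xn xf xf1; rewrite (slide_walk (perm_natK w) (perm_natVK w) _ xf xf1).
  rewrite slide_fromS; last by rewrite /= ltnS leq_addr.
  by rewrite (larger_beforeS (perm_natK w) (perm_natVK w) x f).
by move=> z zx; rewrite hD // nth_code // (ltn_trans zx).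
Qed.

(** The walk ends at the smaller entry [w i], whose tower size is the number of larger entries
    before [i]: the letter lands exactly on top. *)
Lemma slide_code (i i' : 'I_n) : i' = i.+1 :> nat -> w i < w i' ->
  slide (code w) i.+1 = Some ((w i).+1, nth 0 (code w) (w i)).
Proof.
move=> hi wi; rewrite (@slide_walk_code _ _ (w i)) ?ltn_ord //; last first.
- by rewrite -hi /W perm_nat_ord ltnW.
- by rewrite /W perm_nat_ord.
rewrite /= {1 2}nth_code // /P perm_nat_ord permK ltnn addn0 -/(L _ _).
rewrite ifF; last lia.
by rewrite ifT //; lia.
Qed.

Section Flight.
Variable c : cell.
Hypotheses (hc : has_cell (code w) c.1 c.2) (ntop : ~~ has_cell (code w) c.1 c.2.+1).

Let y := c.1.-1.

Let c1 : c.1 = y.+1. Proof. by case/andP: hc; rewrite /y; case: c.1. Qed.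

Let code_y : nth 0 (code w) y = c.2.+1.
Proof.
move: hc ntop; rewrite /has_cell c1 /= -leqNgt => h1 h2.
by apply/eqP; rewrite eqn_leq h1 h2.
Qed.

Let yn : y < n.
Proof.
rewrite -(size_code w) ltnNge; apply/negP => h.
by move: code_y; rewrite nth_default.
Qed.

Let D' := remove_cell (code w) c.

Let D'y : nth 0 D' y = c.2. Proof. by rewrite nth_remove_cell eqxx. Qed.

Let D'ne z : z != y -> nth 0 D' z = nth 0 (code w) z.
Proof. by rewrite nth_remove_cell => /negbTE ->. Qed.

Let D'lt z : z < y -> nth 0 D' z = nth 0 (code w) z.
Proof. by move=> zy; rewrite D'ne // neq_ltn zy. Qed.

Let codeP x : x < n -> nth 0 (code w) x = L x.+1 (P x). Proof. exact: nth_code. Qed.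

Let past a : y < a -> slide_from D' y.+2 a.+1 <> Some c.
Proof. by move=> ya /slide_from_top [|]; rewrite ?c1 ?ltnn. Qed.

(** The slide follows the code until it meets the tower [y] of [c] or that of the smaller of the two
    entries exchanged by the letter. If this entry is smaller than [y], the slide ends there, by
    adding another cell or by terminating. At [y] it adds [c] only if [y] is the second entry of a
    descent. *)
Lemma is_flight_code f :
  is_flight (code w) c f <->
  exists i i' : 'I_n, [/\ i' = i.+1 :> nat, f = i.+1, w i' < w i & c.1 = (w i').+1].
Proof.
rewrite /is_flight -/D'; split; last first.
  move=> [i [i' [hi -> wi c1i]]]; have yi : y = w i' by rewrite /y c1i.
  rewrite /= (@slide_walk_code _ _ y) //; last first.
  - by rewrite -hi /W perm_nat_ord yi.
  - by rewrite /W perm_nat_ord yi ltnW.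
  have E : c.2 = L y.+1 i.
    apply: eq_add_S; rewrite -code_y codeP // /P yi perm_nat_ord permK hi.
    by rewrite /L larger_beforeSr /W perm_nat_ord wi addn1.
  rewrite /= D'y /P yi perm_nat_ord permK -yi E.
  rewrite ifF; last by rewrite hi; lia.
  rewrite ifT; last by rewrite hi; lia.
  by rewrite [X in _ == Some X]surjective_pairing c1 E.
case/andP; case: f => // f _ /eqP.
have Wne : W f <> W f.+1.
  by move/(congr1 (perm_nat w^-1%g)); rewrite /W !perm_natK; lia.
have PW k : P (W k) = k by rewrite /P /W perm_natK.
have Wk x : x <= W f -> L x f.+1 = (L x f).+1.
  by move=> h; rewrite /L larger_beforeSr h addn1.
have [yf|fy|Ey] := ltngtP y (W f).
- have [yf1|f1y|Ey1] := ltngtP y (W f.+1).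
  + rewrite (@slide_walk_code _ _ y) ?(ltnW yf) ?(ltnW yf1) //=.
    rewrite D'y; have := code_y; rewrite codeP //.
    have Py : P y <> f by move=> E; move: yf; rewrite -E /W /P perm_natVK ltnn.
    have Py1 : P y <> f.+1 by move=> E; move: yf1; rewrite -E /W /P perm_natVK ltnn.
    case: (ltnP (P y) f) => h /=.
      have := leq_larger_before W y.+1 (ltnW h); rewrite -/L => h1 h2.
      by rewrite ifT; [move=> /past; case; lia | lia].
    have h1 := @larger_before_ltn W y.+1 f f.+1 (ltnSn f) yf.
    have h2 : L y.+1 f.+1 < L y.+1 (P y) by apply: larger_before_ltn => //; lia.
    rewrite -/L in h1 => h3; rewrite ifF; last lia.
    rewrite ifF; last lia.
    by case: ifP => // _ /past; case; lia.
  + rewrite (@slide_walk_code _ _ (W f.+1)) //=; last first.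
    * lia.
    * lia.
    * by move=> z zx; apply: D'lt; lia.
    (* The smaller entry stands at [f.+1], so its tower has one cell more than the letter needs and
       the sliding terminates. *)
    rewrite D'lt // codeP; last lia.
    rewrite PW (Wk (W f.+1).+1); last lia.
    rewrite ifF; last lia.
    rewrite ifF; last lia.
    by rewrite ifT //; lia.
  + move=> _; have f1n : f.+1 < n.
      by rewrite ltnNge; apply/negP => h; move: yn; rewrite Ey1 /W perm_nat_geq //; lia.
    exists (Ordinal (ltnW f1n)), (Ordinal f1n); split=> //.
      by rewrite -!(perm_nat_ord w) /= -/W -Ey1.
    by rewrite c1 Ey1 -(perm_nat_ord w).
- have [f1|f1|E//] := ltngtP (W f) (W f.+1).
    rewrite (@slide_walk_code _ _ (W f)) //=; last first.
    + lia.
    + lia.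
    + by move=> z zx; apply: D'lt; lia.
    rewrite D'lt // codeP; last lia.
    rewrite PW ltnn ifF; last lia.
    rewrite ifT; last lia.
    by move=> [E]; move: c1 fy; rewrite -E /=; lia.
  rewrite (@slide_walk_code _ _ (W f.+1)) //=; last first.
  + lia.
  + lia.
  + by move=> z zx; apply: D'lt; lia.
  rewrite D'lt // ?codeP; [|lia|lia].
  rewrite PW (Wk (W f.+1).+1); last lia.
  rewrite ifF; last lia.
  rewrite ifF; last lia.
  by rewrite ifT //; lia.
have [f1|f1|E] := ltngtP y (W f.+1).
- rewrite (@slide_walk_code _ _ y) //=; last first.
  + exact: ltnW.
  + by rewrite Ey.
  rewrite D'y; have := code_y; rewrite codeP // {2 4 6 8}Ey PW ltnn => h.
  by rewrite ifT; [move=> /past; case; lia | lia].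
- rewrite (@slide_walk_code _ _ (W f.+1)) //=; last first.
  + lia.
  + lia.
  + by move=> z zx; apply: D'lt; lia.
  rewrite D'lt // ?codeP; [|lia].
  rewrite PW (Wk (W f.+1).+1); last lia.
  rewrite ifF; last lia.
  rewrite ifF; last lia.
  by rewrite ifT //; lia.
by case: Wne; rewrite -Ey -E.
Qed.

End Flight.
End Corners.

(** * Standard tower tableaux *)

(** The free place above a tower, in contrast with [top_cell], the last cell of a tower. *)
Definition top_position (T : tableau) (c : cell) : Prop :=
  0 < c.1 /\ c.2 = size (nth [::] T c.1.-1).

Lemma nth_tower_shape (T : tableau) z : nth 0 (shape T) z = size (nth [::] T z).
Proof.
case: (ltnP z (size T)) => h; first by rewrite (nth_map [::]).
by rewrite !nth_default // size_map.
Qed.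

Lemma label_put_label T c x d : 0 < c.1 -> 0 < d.1 ->
  label (put_label T c x) d = if d == c then x else label T d.
Proof.
case: c d => [c1 c2] [d1 d2] /= c0 d0; rewrite /label /put_label nth_set_nth /=.
rewrite xpair_eqE (_ : (d1.-1 == c1.-1) = (d1 == c1)); last lia.
by case: eqP => [->|] //=; rewrite nth_set_nth.
Qed.

Lemma set_nth_size (V : Type) (a : V) s x : set_nth a s (size s) x = rcons s x.
Proof. by elim: s => //= y s ->. Qed.

Lemma nth_put_label T c x z : top_position T c ->
  nth [::] (put_label T c x) z =
    if z == c.1.-1 then rcons (nth [::] T z) x else nth [::] T z.
Proof.
move=> [_ hc]; rewrite /put_label nth_set_nth /=; case: eqP => // ->.
by rewrite hc set_nth_size.
Qed.

Lemma nth_shape_put_label T c x z : top_position T c ->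
  nth 0 (shape (put_label T c x)) z = nth 0 (shape T) z + (z == c.1.-1).
Proof.
move=> hc; rewrite !nth_tower_shape nth_put_label //.
by case: eqP => _; rewrite ?size_rcons ?addn1 ?addn0.
Qed.

Lemma size_put_label T c x : 0 < c.1 -> size (put_label T c x) = maxn c.1 (size T).
Proof. by move=> c0; rewrite size_set_nth prednK. Qed.

Lemma size_flatten_put_label T c x : top_position T c ->
  size (flatten (put_label T c x)) = (size (flatten T)).+1.
Proof.
move=> hc; have [c0 hc2] := hc; rewrite !size_flatten.
have -> : seq.shape (put_label T c x) = set_nth 0 (seq.shape T) c.1.-1 c.2.+1.
  apply: (eq_from_nth (x0 := 0)).
    by rewrite size_map size_put_label // size_set_nth size_map prednK.
  move=> z _; rewrite -!/(shape _) nth_shape_put_label // nth_set_nth /=.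
  by case: eqP => [->|_]; rewrite ?addn0 // nth_tower_shape -hc2 addn1.
rewrite sumn_set_nth -!/(shape _) nth_tower_shape -hc2 mul0n addn0.
have [h|h] := ltnP c.1.-1 (size (shape T)).
  by rewrite /= muln1 addnS subSn ?leq_addl // addnK.
by rewrite /= muln0 subn0 hc2 nth_default ?addn1 //; move: h; rewrite size_map.
Qed.

Lemma nth_restrict T c z :
  nth [::] (restrict T c) z =
    if z == c.1.-1 then take c.2 (nth [::] T z) else nth [::] T z.
Proof. by rewrite /restrict nth_set_nth /=; case: eqP => // ->. Qed.

Lemma size_restrict T c : 0 < c.1 <= size T -> size (restrict T c) = size T.
Proof. by move=> h; rewrite size_set_nth; apply/maxn_idPr; lia. Qed.

Lemma restrict_put_label T c x : top_position T c -> c.1 <= size T ->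
  restrict (put_label T c x) c = T.
Proof.
move=> hc cT; have [c0 hc2] := hc; have sP : size (put_label T c x) = size T.
  by rewrite size_put_label //; apply/maxn_idPr.
have sR : size (restrict (put_label T c x) c) = size T.
  by rewrite size_restrict sP // c0.
apply: (eq_from_nth (x0 := [::])) => // z _.
rewrite nth_restrict nth_put_label //; case: eqP => // ->.
by rewrite hc2 -cats1 take_size_cat.
Qed.

Lemma slide_top_position T a c : 0 < a ->
  slide (shape T) a = Some c -> top_position T c.
Proof. by move=> a0 /slide_top /(_ a0) []; rewrite nth_tower_shape. Qed.

Lemma label_top T c : top_position T c -> label T c = 0.
Proof. by move=> [_ hc]; rewrite /label nth_default // hc. Qed.

Lemma slide_word_rcons T k alpha a :
  slide_word T k (rcons alpha a) =
    if slide_word T k alpha is Some U then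
      if slide (shape U) a is Some c then Some (put_label U c (k + size alpha))
      else None
    else None.
Proof.
elim: alpha T k => [|b alpha IH] T k /=; first by rewrite addn0.
by case: slide => // c; rewrite IH addSnnS.
Qed.

Lemma std_tableau_rcons n alpha a :
  std_tableau n (rcons alpha a) =
    if 0 < a then
      if std_tableau n alpha is Some U then
        if slide (shape U) a is Some c then Some (put_label U c (size alpha).+1)
        else None
      else None
    else None.
Proof.
rewrite /std_tableau all_rcons slide_word_rcons add1n.
by case: (0 < a); case: all.
Qed.

Lemma std_tableau_rconsP n alpha a U : std_tableau n (rcons alpha a) = Some U ->
  exists U0 c, [/\ 0 < a, std_tableau n alpha = Some U0,
    slide (shape U0) a = Some c, top_position U0 c
    & U = put_label U0 c (size alpha).+1].
Proof.
rewrite std_tableau_rcons; case: (ltnP 0 a) => // a0.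
case E0: std_tableau => [U0|//]; case Ec: slide => [c|//] [<-].
by exists U0, c; split=> //; apply: slide_top_position Ec.
Qed.

Lemma label_nseq n d : label (nseq n [::]) d = 0.
Proof. by rewrite /label nth_nseq if_same nth_nil. Qed.

Lemma std_tableau_size n alpha U : std_tableau n alpha = Some U -> n <= size U.
Proof.
elim/last_ind: alpha U => [|be a IH] V.
  by move=> [<-]; rewrite size_nseq.
case/std_tableau_rconsP=> V0 [c [_ /IH h _ [c0 _] ->]].
by rewrite size_put_label // leq_max h orbT.
Qed.

Lemma std_tableau_flatten n alpha U : std_tableau n alpha = Some U ->
  size (flatten U) = size alpha.
Proof.
elim/last_ind: alpha U => [|be a IH] V.
  by move=> [<-]; elim: n.
case/std_tableau_rconsP=> V0 [c [_ /IH h _ hc ->]].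
by rewrite size_flatten_put_label // h size_rcons.
Qed.

Lemma std_tableau_label_le n alpha U d : std_tableau n alpha = Some U ->
  0 < d.1 -> label U d <= size alpha.
Proof.
elim/last_ind: alpha U => [|be a IH] V.
  by move=> [<-]; rewrite label_nseq.
case/std_tableau_rconsP=> V0 [c [_ /IH h _ [c0 _] ->]] d0.
by rewrite label_put_label // size_rcons; case: eqP => // _; apply/leqW/h.
Qed.

Lemma std_tableau_label_ex n alpha U r : std_tableau n alpha = Some U ->
  0 < r <= size alpha -> exists2 d, 0 < d.1 & label U d = r.
Proof.
elim/last_ind: alpha U => [|be a IH] V; first by case: r.
case/std_tableau_rconsP=> V0 [c [_ /IH h _ hc ->]]; have [c0 _] := hc.
rewrite size_rcons => /andP[r0]; rewrite leq_eqVlt ltnS => /orP[/eqP ->|rs].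
  by exists c => //; rewrite label_put_label // eqxx.
have [|d d0 dr] := h; first by rewrite r0.
exists d => //; rewrite label_put_label //; case: eqP => // E.
by move: r0; rewrite -dr E (label_top hc).
Qed.

Lemma std_tableau_label_inj n alpha U d e : std_tableau n alpha = Some U ->
  0 < d.1 -> 0 < e.1 -> 0 < label U d -> label U d = label U e -> d = e.
Proof.
elim/last_ind: alpha U => [|be a IH] V.
  by move=> [<-]; rewrite label_nseq.
case/std_tableau_rconsP=> V0 [c [_ hV0 _ [c0 _] ->]] d0 e0.
have := std_tableau_label_le hV0 d0; have := std_tableau_label_le hV0 e0.
rewrite !label_put_label //; case: eqP => [->|_]; case: eqP => [->|_] //.
- by move=> h _ _ E; move: h; rewrite -E ltnn.
- by move=> _ h _ E; move: h; rewrite E ltnn.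
- by move=> _ _; apply: IH hV0 d0 e0.
Qed.

Lemma cell_of_labelP U r d : 0 < r -> 0 < d.1 -> label U d = r ->
  (forall e, 0 < e.1 -> label U e = r -> e = d) -> cell_of_label U r = d.
Proof.
move=> r0 d0 dr uniq; apply: uniq => //; rewrite /cell_of_label.
set i := find _ _.
have hr : has (fun t => r \in t) U.
  have dU : d.1.-1 < size U.
    rewrite ltnNge; apply/negP => h; move: r0; rewrite -dr /label.
    by rewrite [nth [::] _ _]nth_default // nth_nil.
  apply/hasP; exists (nth [::] U d.1.-1); first exact: mem_nth.
  rewrite -dr /label mem_nth // ltnNge; apply/negP => h.
  by move: r0; rewrite -dr /label nth_default.
by rewrite /label /= nth_index // (nth_find [::] hr).
Qed.

Lemma cell_of_label_std n alpha U d : std_tableau n alpha = Some U ->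
  0 < d.1 -> 0 < label U d -> cell_of_label U (label U d) = d.
Proof.
move=> hU d0 l0; apply: cell_of_labelP => // e e0 E.
by apply: std_tableau_label_inj hU e0 d0 _ _; rewrite E.
Qed.

Lemma cell_of_label_put_label n alpha a U U0 c :
    std_tableau n alpha = Some U0 -> std_tableau n (rcons alpha a) = Some U ->
    top_position U0 c -> U = put_label U0 c (size alpha).+1 ->
  cell_of_label U (size alpha).+1 = c /\
  forall r, 0 < r <= size alpha ->
    [/\ cell_of_label U r = cell_of_label U0 r, 0 < (cell_of_label U0 r).1,
        label U0 (cell_of_label U0 r) = r & cell_of_label U0 r != c].
Proof.
move=> hU0 hU hc EU; have [c0 _] := hc.
have lc : label U c = (size alpha).+1 by rewrite EU label_put_label // eqxx.
split; first by rewrite -lc (cell_of_label_std hU) // lc.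
move=> r rs; have [d d0 dr] := std_tableau_label_ex hU0 rs.
have r0 : 0 < r by case/andP: rs.
have -> : cell_of_label U0 r = d by rewrite -dr (cell_of_label_std hU0) ?dr.
have dc : d != c.
  by apply: contraTneq r0 => E; rewrite -dr E (label_top hc).
have dU : label U d = r by rewrite EU label_put_label // (negbTE dc).
by split=> //; rewrite -dU (cell_of_label_std hU) ?dU.
Qed.

(** The largest label marks the last added cell. Its removal gives the tableau of both prefixes, and
    [slide_from_inj] recovers the last letter. *)
Lemma std_tableau_inj n alpha be U : size U = n ->
  std_tableau n alpha = Some U -> std_tableau n be = Some U -> alpha = be.
Proof.
move=> sU; elim/last_ind: alpha be U sU => [|alpha a IH] be U sU hA hB.
  by have := std_tableau_flatten hB; rewrite (std_tableau_flatten hA); case: (be).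
have sAB : size be = (size alpha).+1.
  by rewrite -(std_tableau_flatten hB) (std_tableau_flatten hA) size_rcons.
case/lastP: be sAB hB => // be b; rewrite size_rcons => -[sAB] hB.
have [U0 [c [a0 hU0 slA hc EU]]] := std_tableau_rconsP hA.
have [U1 [d [b0 hU1 slB hd EU']]] := std_tableau_rconsP hB.
have [E1 _] := cell_of_label_put_label hU0 hA hc EU.
have [E2 _] := cell_of_label_put_label hU1 hB hd EU'.
have E : d = c by rewrite -E2 sAB E1.
rewrite E in slB hd EU'; have [c0 _] := hc.
(* [put_label] may lengthen the list of towers; as the final tableau has only [n] of them, the
   earlier ones have [n] too. *)
have le V : size U = maxn c.1 (size V) -> n <= size V ->
  size V = n /\ c.1 <= size V by lia.
have [s0 l0] : size U0 = n /\ c.1 <= size U0.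
  by apply: le (std_tableau_size hU0); rewrite EU size_put_label.
have [s1 l1] : size U1 = n /\ c.1 <= size U1.
  by apply: le (std_tableau_size hU1); rewrite EU' size_put_label.
have EU01 : U0 = U1.
  rewrite -(restrict_put_label (size alpha).+1 hc l0) -EU.
  by rewrite EU' restrict_put_label.
rewrite -EU01 in hU1 slB; rewrite (IH be U0 s0 hU0 hU1); congr rcons.
by apply: (@slide_from_inj (shape U0) 1 a b c).
Qed.

Lemma reading_word_std n alpha U : size U = n ->
  std_tableau n alpha = Some U -> reading_word U = alpha.
Proof.
move=> sU hA; rewrite /reading_word sU; apply: xget_unique => // be hB.
exact: std_tableau_inj hB hA.
Qed.

(** * Codes, standard tableaux and Rothification along a reduced word *)

Lemma nth_code_tperm n (w : 'S_n) (i i' : 'I_n) z : i' = i.+1 :> nat -> w i' < w i ->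
  nth 0 (code w) z = nth 0 (code (tperm i i' * w)%g) z + (z == w i').
Proof.
move=> hi wi; have [zn|nz] := ltnP z n; last first.
  rewrite !nth_default ?size_code //; case: eqP => // E.
  by move: nz; rewrite E leqNgt ltn_ord.
pose c := Ordinal zn; rewrite -[z]/(val c) !nth_code_count !count_enum_ord.
rewrite [X in _ = X + _](reindex_inj (@perm_inj _ (tperm i i'))) /=.
rewrite (bigD1 i) //= [X in _ = X + _](bigD1 i) //= tpermL.
rewrite (eq_bigr (fun r => ((tperm i i' r, c) \in rothe (tperm i i' * w)%g) : nat)).
  have [E|ne] := eqVneq z (w i').
    have -> : c = w i' by apply: val_inj.
    by rewrite mem_rothe_desc // (negbTE (notin_rothe_tperm w hi)) add0n addnC.
  rewrite addn0 -(mem_rothe_tperm hi wi) ?tpermL //.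
  by rewrite xpair_eqE eqxx; apply: contra_neq ne => <-.
by move=> r ri; rewrite mem_rothe_tperm // xpair_eqE (negbTE ri).
Qed.

Lemma perm_natM n (u s : 'S_n) k : perm_nat (u * s)%g k = perm_nat s (perm_nat u k).
Proof.
have [kn|nk] := ltnP k n; last by rewrite !perm_nat_geq.
by rewrite -[k]/(val (Ordinal kn)) !perm_nat_ord permM.
Qed.

Lemma perm_nat_tpermK n (i i' : 'I_n) : involutive (perm_nat (tperm i i')).
Proof.
by move=> k; rewrite -perm_natM tperm2 /perm_nat; case: insubP => // j _ <-; rewrite perm1.
Qed.

(** Each letter exchanges an ascent, and [slide_code] puts the new cell in the tower of the smaller
    entry, precisely where the code grows. *)
Lemma std_tableau_reduced_word n (w : 'S_n) alpha : reduced_word w alpha ->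
  exists U, [/\ std_tableau n alpha = Some U, shape U = code w
    & forall r, 0 < r <= size alpha -> (cell_of_label U r).1 =
        (perm_nat (word_perm n (take r.-1 alpha)) (nth 0 alpha r.-1).-1).+1].
Proof.
elim/last_ind: alpha w => [|alpha a IH] w.
  case/reduced_wordP => _ _ /esym E; exists (nseq n [::]); split=> //; last by case.
  apply: (eq_from_nth (x0 := 0)) => [|z].
    by rewrite size_map size_nseq size_code.
  rewrite size_map size_nseq => zn; rewrite nth_tower_shape nth_nseq if_same.
  rewrite (nth_code_count _ (Ordinal zn)); apply/esym/eqP.
  rewrite -leqn0 leqNgt -has_count; apply/hasPn => r _ /=.
  apply/negP => /imsetP[p hp _]; move/eqP: E; rewrite cards_eq0 => /eqP E.
  by rewrite E inE in hp.
move=> red; have [i [i' [hi -> wi red0]]] := reduced_word_rcons red.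
have [U0 [hU0 sU0 cU0]] := IH _ red0; have [_ Ev _] := reduced_wordP _ _ red0.
set v := (tperm i i' * w)%g in red0 sU0 Ev.
have vi : v i = w i' by rewrite permM tpermL.
have sl : slide (shape U0) i.+1 = Some ((w i').+1, nth 0 (code v) (w i')).
  by rewrite sU0 (@slide_code n v i i') ?vi // permM tpermR.
set c := (_, _) in sl; exists (put_label U0 c (size alpha).+1).
have hc : top_position U0 c by apply: slide_top_position sl.
have hU : std_tableau n (rcons alpha i.+1) = Some (put_label U0 c (size alpha).+1).
  by rewrite std_tableau_rcons hU0 sl.
have sU0n : size U0 = n by rewrite -(size_map size) -/(shape U0) sU0 size_code.
split=> //.
  apply: (eq_from_nth (x0 := 0)) => [|z _].
    rewrite size_map size_put_label // sU0n size_code; apply/maxn_idPr.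
    exact: ltn_ord.
  by rewrite nth_shape_put_label // sU0 (nth_code_tperm z hi wi).
have [E1 E2] := cell_of_label_put_label hU0 hU hc erefl.
move=> r /andP[r0]; rewrite size_rcons leq_eqVlt ltnS => /orP[/eqP ->|rs].
  rewrite E1 /= -cats1 take_size_cat // nth_cat ltnn subnn /= Ev.
  by rewrite perm_nat_ord vi.
have r0s : 0 < r <= size alpha by rewrite r0.
have [-> _ _ _] := E2 r r0s; rewrite cU0 // -cats1 takel_cat; last lia.
by rewrite nth_cat ifT //; lia.
Qed.

(* The [r]-th letter exchanges two entries: the column is the smaller one, and
   the row is the final position of the larger one, which is computed by the
   reversed remaining letters. *)
Definition rothe_cell n alpha (r : nat) : nat * nat :=
  ((perm_nat (word_perm n (rev (drop r alpha))) (nth 0 alpha r.-1).-1).+1,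
   (perm_nat (word_perm n (take r.-1 alpha)) (nth 0 alpha r.-1).-1).+1).

Lemma rothify_cellE n (w : 'S_n) alpha U r : reduced_word w alpha ->
    std_tableau n alpha = Some U -> 0 < r <= size alpha ->
  rothify_cell U r = rothe_cell n alpha r.
Proof.
move=> red hU rs; have [V [hV sV cV]] := std_tableau_reduced_word red.
have EV : V = U by move: hV; rewrite hU => -[].
subst V; have sU : size U = n by rewrite -(size_map size) -/(shape U) sV size_code.
rewrite /rothify_cell sU (reading_word_std sU hU).
have [V [hV' _ cV']] := std_tableau_reduced_word (rev_reduced_word red).
rewrite hV' [odflt _ _]/= cV // cV'; last by rewrite size_rev; lia.
(* The label [l + 1 - r] of the reversed word, [l] being the length, belongs to the [r]-th letter of
   [alpha], preceded there by the later letters in reverse. *)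
rewrite /rothe_cell (_ : ((size alpha).+1 - r).-1 = size alpha - r); last lia.
rewrite take_rev subKn; last lia.
rewrite nth_rev; last lia.
by rewrite (_ : size alpha - (size alpha - r).+1 = r.-1) //; lia.
Qed.

Lemma rothe_cell_rcons n alpha (i i' : 'I_n) r : i' = i.+1 :> nat ->
    0 < r <= size alpha ->
  rothe_cell n (rcons alpha i.+1) r =
    ((perm_nat (tperm i i') (rothe_cell n alpha r).1.-1).+1, (rothe_cell n alpha r).2).
Proof.
move=> hi rs; rewrite /rothe_cell drop_rcons; last lia.
rewrite rev_rcons word_perm_cons (simple_transposition_ord hi) perm_natM.
rewrite nth_rcons ifT; last lia.
by rewrite -cats1 takel_cat //; lia.
Qed.

Lemma rothe_cell_last n alpha (i i' : 'I_n) : i' = i.+1 :> nat ->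
  rothe_cell n (rcons alpha i.+1) (size alpha).+1 =
    (i.+1, (word_perm n alpha i).+1).
Proof.
move=> hi; rewrite /rothe_cell drop_oversize ?size_rcons //= nth_rcons ltnn eqxx /=.
by rewrite -cats1 take_size_cat // !perm_nat_ord /word_perm /= perm1.
Qed.

Lemma rothe_cell_tperm n alpha (i i' : 'I_n) r (x : 'I_n * 'I_n) : i' = i.+1 :> nat ->
    0 < r <= size alpha ->
  (rothe_cell n (rcons alpha i.+1) r == (x.1.+1, x.2.+1)) =
  (rothe_cell n alpha r == ((tperm i i' x.1).+1, x.2.+1)).
Proof.
move=> hi rs; rewrite (rothe_cell_rcons hi) // /rothe_cell /= !xpair_eqE.
congr (_ && _); rewrite !eqSS -(perm_nat_ord (tperm i i') x.1).
by apply/eqP/eqP => [<-|->]; rewrite perm_nat_tpermK.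
Qed.

(** Ensures that no earlier label is moved to the place of the new cell when the rows are
    exchanged. *)
Lemma rothe_cell_mem n (w : 'S_n) alpha r (x : 'I_n * 'I_n) :
    reduced_word w alpha -> 0 < r <= size alpha ->
  rothe_cell n alpha r = (x.1.+1, x.2.+1) -> x \in rothe w.
Proof.
elim/last_ind: alpha w x => [|alpha a IH] w x red; first by case: r.
have [i [i' [hi Ea wi red0]]] := reduced_word_rcons red; subst a.
rewrite size_rcons => /andP[r0]; rewrite leq_eqVlt ltnS => /orP[/eqP ->|rs].
  have [_ Ev _] := reduced_wordP _ _ red0; rewrite (rothe_cell_last _ hi) Ev permM tpermL.
  case: x => a b /= [E1 E2]; rewrite -(val_inj E1 : i = a) -(val_inj E2 : w i' = b).
  exact: mem_rothe_desc.
have r0s : 0 < r <= size alpha by rewrite r0.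
move/eqP; rewrite (rothe_cell_tperm _ hi) // => /eqP E.
have := IH _ (tperm i i' x.1, x.2) red0 r0s E.
have [->|ne] := eqVneq x (i, w i'); first by rewrite mem_rothe_desc.
by case: x ne E => a b ne _; rewrite mem_rothe_tperm.
Qed.

Lemma rothify_std_rcons n (w : 'S_n) (i i' : 'I_n) alpha U0 U :
    i' = i.+1 :> nat -> w i' < w i -> reduced_word (tperm i i' * w)%g alpha ->
    std_tableau n alpha = Some U0 -> std_tableau n (rcons alpha i.+1) = Some U ->
  rothify_std n U = add_cell w i i' (size alpha).+1 (rothify_std n U0).
Proof.
move=> hi wi red0 hU0 hU; have red := rcons_reduced_word hi wi red0.
have [_ Ev _] := reduced_wordP _ _ red0.
apply/ffunP => x; rewrite !ffunE /=.
rewrite (std_tableau_flatten hU) (std_tableau_flatten hU0) size_rcons.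
rewrite (_ : iota 1 (size alpha).+1 = rcons (iota 1 (size alpha)) (size alpha).+1); last first.
  by rewrite -[(size alpha).+1 in LHS]addn1 iotaD /= -cats1.
rewrite filter_rcons (rothify_cellE red hU) ?size_rcons ?leqnn //.
rewrite (rothe_cell_last _ hi) Ev permM tpermL.
have -> : [seq r <- iota 1 (size alpha) | rothify_cell U r == (x.1.+1, x.2.+1)] =
    [seq r <- iota 1 (size alpha)
       | rothify_cell U0 r == ((tperm i i' x.1).+1, x.2.+1)].
  apply: eq_in_filter => r; rewrite mem_iota add1n ltnS => rs.
  rewrite (rothify_cellE red hU) ?size_rcons; last lia.
  by rewrite (rothe_cell_tperm _ hi) // (rothify_cellE red0 hU0).
rewrite xpair_eqE !eqSS.
have -> : ((i : nat) == x.1) && ((w i' : nat) == x.2) = (x == (i, w i')).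
  by case: x => a b; rewrite xpair_eqE !val_eqE eq_sym; congr (_ && _); rewrite eq_sym.
case: eqP => [-> /=|//].
rewrite (eq_in_filter (a2 := pred0)) ?filter_pred0 // => r.
rewrite mem_iota add1n ltnS => rs; rewrite (rothify_cellE red0 hU0) // tpermL.
apply/negbTE/eqP => E.
have := @rothe_cell_mem _ _ _ _ (i', w i') red0 rs E.
by rewrite (negbTE (notin_rothe_tperm w hi)).
Qed.

Lemma rothify_std_le n U x : rothify_std n U x <= size (flatten U).
Proof.
rewrite ffunE; set s := filter _ _.
have : all (fun r => r <= size (flatten U)) s.
  by apply/allP => r; rewrite mem_filter mem_iota => /and3P[_ _]; lia.
by case: s => //= r s /andP[].
Qed.

(** * Semi-standard tableaux *)

Lemma size_flatten_shape T : size (flatten T) = sumn (shape T).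
Proof. exact: size_flatten. Qed.

Definition top_cell (T : tableau) (c : cell) : bool :=
  has_cell (shape T) c.1 c.2 && ~~ has_cell (shape T) c.1 c.2.+1.

Section TopCell.
Variables (T : tableau) (c : cell).
Hypothesis hc : top_cell T c.

Lemma top_cellP :
  [/\ 0 < c.1, c.1 <= size T & size (nth [::] T c.1.-1) = c.2.+1].
Proof.
case/andP: hc => h1 h2; have := has_cell_size h1; rewrite size_map.
move: h1 h2; rewrite /has_cell nth_tower_shape => /andP[-> h] /= h2 ->.
by split=> //; apply/eqP; rewrite eqn_leq h leqNgt h2.
Qed.

Lemma top_position_restrict : top_position (restrict T c) c.
Proof.
have [c0 _ sc] := top_cellP; split=> //.
by rewrite nth_restrict eqxx size_takel // sc.
Qed.

Lemma put_label_restrict : put_label (restrict T c) c (label T c) = T.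
Proof.
have [c0 cT sc] := top_cellP; have sR := size_restrict (introT andP (conj c0 cT)).
apply: (eq_from_nth (x0 := [::])) => [|z _].
  by rewrite size_put_label // sR; apply/maxn_idPr.
rewrite (nth_put_label _ _ top_position_restrict) nth_restrict.
case: eqP => // ->; rewrite /label -take_nth ?sc //.
by rewrite take_oversize // sc.
Qed.

Lemma shape_restrict : shape (restrict T c) = remove_cell (shape T) c.
Proof.
have [c0 cT sc] := top_cellP; apply: (eq_from_nth (x0 := 0)) => [|z _].
  rewrite size_map size_restrict ?c0 // size_set_nth size_map.
  by apply/esym/maxn_idPr; lia.
rewrite nth_tower_shape nth_restrict nth_remove_cell nth_tower_shape.
by case: eqP => [->|//]; rewrite size_takel // sc.
Qed.

Lemma size_flatten_restrict : size (flatten T) = (size (flatten (restrict T c))).+1.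
Proof.
by rewrite -{1}put_label_restrict (size_flatten_put_label _ top_position_restrict).
Qed.

Lemma label_restrict d : 0 < d.1 -> d != c -> label T d = label (restrict T c) d.
Proof.
move=> d0 dc; have [c0 _ _] := top_cellP.
by rewrite -{1}put_label_restrict label_put_label // (negbTE dc).
Qed.

End TopCell.

Lemma mem_flatten_label T x : x \in flatten T ->
  exists d, [/\ 0 < d.1, has_cell (shape T) d.1 d.2 & label T d = x].
Proof.
case/flattenP=> t /(nthP [::])[z zT <-] /(nthP 0)[j jz <-].
by exists (z.+1, j); split=> //=; rewrite /has_cell /= nth_tower_shape.
Qed.

Lemma label_le_max T d : label T d <= max_label T.
Proof.
rewrite /label; case: (ltnP d.2 (size (nth [::] T d.1.-1))) => h; last by rewrite nth_default.
have : nth 0 (nth [::] T d.1.-1) d.2 \in flatten T.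
  apply/flattenP; exists (nth [::] T d.1.-1); last exact: mem_nth.
  rewrite mem_nth // ltnNge; apply/negP => h2; move: h.
  by rewrite [nth [::] _ _]nth_default.
rewrite /max_label; elim: (flatten T) => // y s IH; rewrite inE /= leq_max.
by case/orP => [/eqP ->|/IH ->]; rewrite ?leqnn ?orbT.
Qed.

Lemma mem_max_label T : 0 < size (flatten T) -> max_label T \in flatten T.
Proof.
rewrite /max_label; case: (flatten T) => // x s _; elim: s x => [|y s IH] x /=.
  by rewrite maxn0 mem_head.
have := IH y; rewrite /= !inE; case: (leqP x (maxn y (foldr maxn 0 s))) => _ h.
  by rewrite h orbT.
by rewrite eqxx.
Qed.

Lemma mem_cells D c : has_cell D c.1 c.2 -> c \in cells D.
Proof.
move=> h; have := has_cell_size h; case/andP: h => h0 h1 h2.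
apply/allpairsPdep; exists c.1, c.2; rewrite !mem_iota add1n ltnS h0 h2.
by rewrite add0n h1 -surjective_pairing.
Qed.

Lemma mem_max_corners T c :
  (c \in max_corners T) = corner (shape T) c && (label T c == max_label T).
Proof.
rewrite mem_filter; case: (boolP (corner _ _)) => //= h.
by case/and3P: h => /mem_cells -> _ _; rewrite andbT.
Qed.

Lemma exists_minimal (V : eqType) (f : V -> nat) (s : seq V) : s != [::] ->
  exists2 x, x \in s & all (fun y => f x <= f y) s.
Proof.
elim: s => // x [_ _|y s IH _]; first by exists x; rewrite ?mem_head //= leqnn.
have [//|z zs zmin] := IH; case: (leqP (f x) (f z)) => h.
  exists x; rewrite ?mem_head //= leqnn /=.
  by apply: sub_all zmin => u; apply: leq_trans.
by exists z; rewrite 1?inE ?zs ?orbT //= (ltnW h).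
Qed.

Lemma pivotP T c : pivot T = Some c ->
  c \in max_corners T /\
  forall d, d \in max_corners T -> flight (shape T) c <= flight (shape T) d.
Proof.
rewrite /pivot; set s := filter _ _ => h.
have : c \in s by case: (s) h => // x s' [->]; apply: mem_head.
by rewrite mem_filter => /andP[/allP min cC]; split=> // d /min.
Qed.

Lemma pivot_exists T d : d \in max_corners T -> exists c, pivot T = Some c.
Proof.
move=> dC; have : max_corners T != [::] by apply: contraTneq dC => ->.
case/(exists_minimal (flight (shape T))) => x xC xmin.
rewrite /pivot; set s := filter _ _.
have : x \in s by rewrite mem_filter xmin.
by case: (s) => // c s' _; exists c.
Qed.

Lemma pivot_top T c : pivot T = Some c -> top_cell T c.
Proof.
case/pivotP; rewrite mem_max_corners => /andP[/and3P[h1 h2 _] _] _.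
exact/andP.
Qed.

Lemma semistandardE T : semistandard T =
  (size (flatten T) == 0) ||
  (if pivot T is Some c then semistandard (restrict T c) else false).
Proof.
rewrite /semistandard; case E: (size (flatten T)) => [|m] //=.
case Ec: (pivot T) => [c|//]; have := size_flatten_restrict (pivot_top Ec).
by rewrite E => -[<-].
Qed.

Lemma standardizationE T c : pivot T = Some c ->
  standardization T =
    put_label (standardization (restrict T c)) c (size (flatten T)).
Proof.
move=> Ec; have E := size_flatten_restrict (pivot_top Ec).
by rewrite /standardization E /= Ec.
Qed.

Lemma tower_tableauP T :
  reflect (forall z, all (fun x => 0 < x) (nth [::] T z)) (tower_tableau T).
Proof.
apply: (iffP (all_nthP [::])) => [h z|h z _]; last exact: h.
by case: (ltnP z (size T)) => [/h//|zT]; rewrite nth_default.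
Qed.

Lemma tower_tableau_restrict T c : tower_tableau T -> tower_tableau (restrict T c).
Proof.
move/tower_tableauP => h; apply/tower_tableauP => z; rewrite nth_restrict.
by case: eqP => // _; apply/allP => x /mem_take; apply/allP.
Qed.

Lemma tower_tableau_label T d : tower_tableau T ->
  has_cell (shape T) d.1 d.2 -> 0 < label T d.
Proof.
move/tower_tableauP/(_ d.1.-1)/allP => h /andP[_]; rewrite nth_tower_shape => hd.
by apply: h; apply: mem_nth.
Qed.

(** The height is taken in the smaller diagram: the cell is a free place for [w s_i] and the top of
    its tower for [w]. *)
Definition descent_cell n (w : 'S_n) (i i' : 'I_n) : cell :=
  ((w i').+1, nth 0 (code (tperm i i' * w)%g) (w i')).

Section DescentCell.
Variables (n : nat) (w : 'S_n).

Lemma nth_code_desc (i i' : 'I_n) : i' = i.+1 :> nat -> w i' < w i ->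
  nth 0 (code w) (w i') = (nth 0 (code (tperm i i' * w)%g) (w i')).+1.
Proof. by move=> hi wi; rewrite (nth_code_tperm _ hi wi) eqxx addn1. Qed.

Lemma corner_code c : corner (code w) c ->
  exists i i' : 'I_n, [/\ i' = i.+1 :> nat, w i' < w i,
    c = descent_cell w i i', is_flight (code w) c i.+1
    & flight (code w) c = i.+1].
Proof.
case/and3P=> h1 h2 fl.
have memf : is_flight (code w) c (flight (code w) c).
  move: fl; rewrite /flight; set s := filter _ _ => fl.
  have : head 0 s \in s by case: (s) fl => //= x s' _; apply: mem_head.
  by rewrite mem_filter => /andP[].
have [i [i' [hi Ef wi c1]]] := (is_flight_code h1 h2 _).1 memf.
exists i, i'; split=> //; [|by rewrite -Ef..].
rewrite [c]surjective_pairing /descent_cell.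
rewrite c1; congr (_, _); apply: eq_add_S; rewrite -(nth_code_desc hi wi).
move: h1 h2; rewrite /has_cell c1 /= -leqNgt => h1 h2.
by apply/eqP; rewrite eqn_leq h1 h2.
Qed.

Lemma descent_corner (i i' : 'I_n) : i' = i.+1 :> nat -> w i' < w i ->
  corner (code w) (descent_cell w i i') /\
  flight (code w) (descent_cell w i i') = i.+1.
Proof.
move=> hi wi; set c := descent_cell w i i'.
have E := nth_code_desc hi wi.
have h1 : has_cell (code w) c.1 c.2 by rewrite /has_cell /= E.
have h2 : ~~ has_cell (code w) c.1 c.2.+1 by rewrite /has_cell /= E ltnn.
have co : corner (code w) c.
  rewrite /corner h1 h2; apply/flightP; exists i.+1.
  by apply/(is_flight_code h1 h2); exists i, i'.
(* The tower of the corner determines the entry [w i'], hence the descent and the flight number. *)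
split=> //; have [j [j' [hj wj [Ec _] _ ->]]] := corner_code co.
by have := perm_val_inj Ec; rewrite hi hj => -[->].
Qed.

End DescentCell.

(** * Sorting the columns of a labelling *)

Lemma sort_cons_max M s : all (geq M) s -> sort leq (M :: s) = rcons (sort leq s) M.
Proof.
move=> sM; apply: (sorted_eq leq_trans anti_leq).
- exact: sort_sorted leq_total _.
- rewrite (sorted_pairwise leq_trans) pairwise_rcons -(sorted_pairwise leq_trans).
  rewrite (sort_sorted leq_total) andbT all_sort //.
- by rewrite perm_sort perm_sym perm_rcons perm_cons perm_sort.
Qed.

Definition column n (w : 'S_n) (B : labelling n) (c : 'I_n) : seq nat :=
  [seq B (r, c) | r <- enum 'I_n & (r, c) \in rothe w].

Lemma nth_sort_columns n (w : 'S_n) (B : labelling n) (c : 'I_n) :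
  nth [::] (sort_columns w B) c = sort leq (column w B c).
Proof. by rewrite (nth_map c) ?size_enum_ord // nth_ord_enum. Qed.

Lemma size_sort_columns n (w : 'S_n) (B : labelling n) : size (sort_columns w B) = n.
Proof. by rewrite size_map size_enum_ord. Qed.

Lemma shape_sort_columns n (w : 'S_n) (B : labelling n) :
  shape (sort_columns w B) = code w.
Proof.
rewrite /shape -map_comp; apply: eq_map => c /=.
by rewrite size_sort size_map size_filter.
Qed.

Lemma mem_sort_columns n (w : 'S_n) (B : labelling n) y :
  reflect (exists2 x, x \in rothe w & B x = y) (y \in flatten (sort_columns w B)).
Proof.
apply: (iffP flattenP) => [[t /mapP[c _ ->]]|[[r c] rc <-]].
  rewrite mem_sort => /mapP[r]; rewrite mem_filter => /andP[rc _] ->.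
  by exists (r, c).
exists (sort leq (column w B c)); first by apply/mapP; exists c; rewrite ?mem_enum.
by rewrite mem_sort; apply: map_f; rewrite mem_filter rc mem_enum.
Qed.

Lemma tower_tableau_sort_columns n (w : 'S_n) (B : labelling n) :
  on_rothe w B -> tower_tableau (sort_columns w B).
Proof.
move=> Bw; apply/allP => t tT; apply/allP => y yt.
have /mem_sort_columns[x xw <-] : y \in flatten (sort_columns w B).
  by apply/flattenP; exists t.
by rewrite Bw.
Qed.

Lemma count_column n (w : 'S_n) (B : labelling n) (c : 'I_n) a :
  count a (column w B c) = \sum_r (((r, c) \in rothe w) && a (B (r, c))).
Proof.
rewrite count_map count_filter count_enum_ord; apply: eq_bigr => r _ /=.
by rewrite andbC.
Qed.

(** The exchange of rows only permutes a column, so sorting sees nothing but the added cell. *)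
Lemma column_add_cell n (w : 'S_n) (i i' : 'I_n) M (B : labelling n) (c : 'I_n) :
    i' = i.+1 :> nat -> w i' < w i ->
  perm_eq (column w (add_cell w i i' M B) c)
    (if c == w i' then M :: column (tperm i i' * w)%g B c
     else column (tperm i i' * w)%g B c).
Proof.
move=> hi wi; apply/seq.permP => a.
have -> (s : seq nat) : count a (if c == w i' then M :: s else s) =
    ((c == w i') && a M) + count a s by case: eqP.
rewrite !count_column [X in _ = _ + X](reindex_inj (@perm_inj _ (tperm i i'))) /=.
rewrite (bigD1 i) //= [X in _ = _ + X](bigD1 i) //= tpermL ffunE xpair_eqE eqxx /=.
rewrite addnA; congr (_ + _); last first.
  apply: eq_bigr => r ri; rewrite mem_rothe_tperm // ?ffunE.
    by rewrite xpair_eqE (negbTE ri).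
  by rewrite xpair_eqE (negbTE ri).
have [->|ne] := eqVneq c (w i').
  by rewrite mem_rothe_desc // (negbTE (notin_rothe_tperm w hi)) addn0.
rewrite -(mem_rothe_tperm hi wi) ?tpermL //.
by rewrite xpair_eqE eqxx.
Qed.

Lemma sort_columns_add_cell n (w : 'S_n) (i i' : 'I_n) M (B : labelling n) :
    i' = i.+1 :> nat -> w i' < w i -> (forall x, B x <= M) ->
  let T := sort_columns (tperm i i' * w)%g B in
  top_position T (descent_cell w i i') /\
  sort_columns w (add_cell w i i' M B) = put_label T (descent_cell w i i') M.
Proof.
move=> hi wi BM T; have hc : top_position T (descent_cell w i i').
  by split=> //; rewrite -nth_tower_shape shape_sort_columns.
split=> //; apply: (eq_from_nth (x0 := [::])) => [|z].
  rewrite size_put_label // !size_sort_columns; apply/esym/maxn_idPr.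
  exact: ltn_ord.
rewrite size_sort_columns => zn; pose c := Ordinal zn.
rewrite nth_put_label //= -[z]/(val c) !nth_sort_columns.
have /(perm_sortP leq_total leq_trans anti_leq) -> := column_add_cell M B c hi wi.
rewrite -val_eqE; case: ifP => // _.
by rewrite sort_cons_max //; apply/allP => y /mapP[r _ ->]; apply: BM.
Qed.

(** * The bijection *)

Lemma shape_restrict_code n (w : 'S_n) (i i' : 'I_n) T c :
    i' = i.+1 :> nat -> w i' < w i -> shape T = code w -> top_cell T c ->
    c = descent_cell w i i' ->
  shape (restrict T c) = code (tperm i i' * w)%g.
Proof.
move=> hi wi sT hc Ec; rewrite shape_restrict // sT.
apply: (eq_from_nth (x0 := 0)) => [|z _].
  by rewrite size_set_nth !size_code Ec /=; apply/maxn_idPr; apply: ltn_ord.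
rewrite nth_remove_cell (nth_code_tperm z hi wi) Ec /=.
by case: eqP => [->|_]; rewrite ?addn0.
Qed.

(** The flight number of the pivot is the last letter of the reading word of the standardization;
    thus Rothification obeys the recursion of labellings. *)
Lemma rothify_add_cell n (w : 'S_n) (i i' : 'I_n) T c alpha :
    i' = i.+1 :> nat -> w i' < w i -> shape T = code w ->
    pivot T = Some c -> c = descent_cell w i i' ->
    is_flight (code w) c i.+1 ->
    reduced_word (tperm i i' * w)%g alpha ->
    std_tableau n alpha = Some (standardization (restrict T c)) ->
  [/\ reduced_word w (rcons alpha i.+1),
      std_tableau n (rcons alpha i.+1) = Some (standardization T)
    & rothify n T = add_cell w i i' (label T c) (rothify n (restrict T c))].
Proof.
move=> hi wi sT Ec EcD fl red0; set U0 := standardization _ => hU0.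
have hc := pivot_top Ec; have [c0 _ _] := top_cellP hc.
have sT0 := shape_restrict_code hi wi sT hc EcD.
have sU0 : shape U0 = shape (restrict T c).
  have [V [hV sV _]] := std_tableau_reduced_word red0.
  by move: hV sV; rewrite hU0 sT0 => -[->].
have sl : slide (shape U0) i.+1 = Some c.
  by rewrite sU0 shape_restrict // sT; case/andP: fl => _ /eqP.
have sz : size (flatten T) = (size alpha).+1.
  by rewrite (size_flatten_restrict hc) -(std_tableau_flatten hU0) !size_flatten_shape sU0.
have EU : standardization T = put_label U0 c (size alpha).+1.
  by rewrite (standardizationE Ec) sz.
have hU : std_tableau n (rcons alpha i.+1) = Some (standardization T).
  by rewrite std_tableau_rcons hU0 sl EU.
split=> //; first exact: rcons_reduced_word red0.
have hcU : top_position U0 c by apply: slide_top_position sl.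
have [E1 E2] := cell_of_label_put_label hU0 hU hcU EU.
apply/ffunP => x; rewrite [LHS]ffunE [RHS]ffunE.
rewrite (rothify_std_rcons hi wi red0 hU0 hU) ffunE.
case: (x =P (i, w i')) => _; first by rewrite E1.
rewrite [RHS]ffunE -/U0; set r := rothify_std _ _ _.
case: eqP => [_ //|r0].
have rs : 0 < r <= size alpha.
  rewrite -(std_tableau_flatten hU0) rothify_std_le andbT; lia.
have [-> d0 _ dc] := E2 r rs; exact: label_restrict.
Qed.

Lemma code0 n (w : 'S_n) T : shape T = code w -> size (flatten T) = 0 ->
  T = nseq n [::] /\ w = 1%g.
Proof.
move=> sT; rewrite size_flatten_shape => sz.
have sTn : size T = n by rewrite -(size_map size) -/(shape T) sT size_code.
have z0 z : nth 0 (code w) z = 0.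
  rewrite -sT; move/eqP: sz; rewrite sumnE sum_nat_seq_eq0.
  by move/all_nthP => h; case: (ltnP z (size (shape T))) => [/(h 0)/eqP //|?]; rewrite nth_default.
split.
  apply: (eq_from_nth (x0 := [::])) => [|z zT]; first by rewrite size_nseq.
  by rewrite nth_nseq if_same; apply: size0nil; rewrite -nth_tower_shape sT.
apply: perm_no_inv; apply/eqP; rewrite cards_eq0; apply/eqP/setP => -[p q].
rewrite !inE /= -mem_rothe; apply/negbTE/negP => h.
have := z0 (w q); rewrite nth_code_count => /eqP; apply/negP.
by rewrite -lt0n -has_count; apply/hasP; exists p; rewrite ?mem_enum.
Qed.

(** The reduced word belongs to the induction because [rothify_add_cell] requires one for the
    smaller tableau. *)
Lemma rothify_semistandard n m (w : 'S_n) T : size (flatten T) = m ->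
    shape T = code w -> tower_tableau T -> semistandard T ->
  [/\ BL w (rothify n T), sort_columns w (rothify n T) = T
    & exists2 alpha, reduced_word w alpha &
        std_tableau n alpha = Some (standardization T)].
Proof.
elim: m w T => [|m IH] w T sz sT tT ssT.
  have [ET Ew] := code0 sT sz; have sU : standardization T = T by rewrite /standardization sz.
  have R0 x : rothify n T x = 0.
    by have := rothify_std_le (standardization T) x; rewrite [rothify n T x]ffunE sU sz leqn0 => ->.
  have D0 x : (x \in rothe w) = false.
    by apply/negP => /imsetP[p]; rewrite Ew inE !perm1 => /andP[]; lia.
  split.
  - by split=> [x|x]; rewrite ?R0 D0.
  - rewrite ET; apply: (proj1 (code0 (shape_sort_columns w _) _)).
    by rewrite size_flatten_shape shape_sort_columns -sT -size_flatten_shape.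
  - exists [::]; last by rewrite sU ET.
    by rewrite Ew; apply/reduced_wordP; rewrite card_inv_pairs1.
move: ssT; rewrite semistandardE sz /=; case Ec: (pivot T) => [c|//] ss0.
have hc := pivot_top Ec; have [cC _] := pivotP Ec.
move: cC; rewrite mem_max_corners sT => /andP[/corner_code[i [i' [hi wi EcD fl _]]] /eqP lc].
have sz0 : size (flatten (restrict T c)) = m.
  by apply: eq_add_S; rewrite -size_flatten_restrict.
have sT0 := shape_restrict_code hi wi sT hc EcD.
have [BL0 Phi0 [alpha red0 hU0]] := IH _ _ sz0 sT0 (tower_tableau_restrict c tT) ss0.
have [red hU ER] := rothify_add_cell hi wi sT Ec EcD fl red0 hU0.
(* By induction the sorted columns give back [restrict T c], so every label is one of [T], and the
   pivot carries the largest. *)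
have BM x : rothify n (restrict T c) x <= label T c.
  case: (boolP (x \in rothe (tperm i i' * w)%g)) => xv; last first.
    by have [+ _] := BL0; move/(_ x); rewrite (negbTE xv); lia.
  have : rothify n (restrict T c) x \in flatten (restrict T c).
    by rewrite -{2}Phi0; apply/mem_sort_columns; exists x.
  case/mem_flatten_label=> d [d0 _ <-]; rewrite lc.
  have [->|dc] := eqVneq d c; first by rewrite (label_top (top_position_restrict hc)).
  by rewrite -label_restrict // label_le_max.
have M0 : 0 < label T c by apply: tower_tableau_label => //; case/andP: hc.
split.
- by rewrite ER; apply: BL_add_cell.
- rewrite ER; have [_ ->] := sort_columns_add_cell hi wi BM.
  by rewrite Phi0 -EcD put_label_restrict.
- by exists (rcons alpha i.+1).
Qed.

Lemma max_label_ge n (w : 'S_n) (B : labelling n) x : on_rothe w B ->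
  B x <= max_label (sort_columns w B).
Proof.
move=> Bw; case: (boolP (x \in rothe w)) => xw; last by move: (Bw x); rewrite (negbTE xw); lia.
have : B x \in flatten (sort_columns w B) by apply/mem_sort_columns; exists x.
by case/mem_flatten_label => d [_ _ <-]; apply: label_le_max.
Qed.

Lemma descent_max_corner n (w : 'S_n) (B : labelling n) (i i' : 'I_n) :
    i' = i.+1 :> nat -> w i' < w i -> BL w B ->
    B (i, w i') = max_label (sort_columns w B) ->
  descent_cell w i i' \in max_corners (sort_columns w B).
Proof.
move=> hi wi [Bw _] BM; rewrite mem_max_corners shape_sort_columns.
have [-> _] := descent_corner hi wi; rewrite -BM /=.
have le x : del_cell w i i' B x <= B (i, w i').
  by rewrite ffunE; case: ifP => // _; rewrite BM; apply: max_label_ge.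
have [[c0 _]] := sort_columns_add_cell hi wi le; rewrite del_cellK => ->.
by rewrite label_put_label // eqxx.
Qed.

Lemma sort_columns_semistandard n m (w : 'S_n) (B : labelling n) :
    BL w B -> size (flatten (sort_columns w B)) = m ->
  semistandard (sort_columns w B) /\ rothify n (sort_columns w B) = B.
Proof.
elim: m w B => [|m IH] w B BLB sz; set T := sort_columns w B in sz *.
  rewrite semistandardE sz; split=> //; apply/ffunP => x; rewrite [LHS]ffunE.
  have [_ Ew] := code0 (shape_sort_columns w B) sz.
  have := rothify_std_le (standardization T) x; rewrite /standardization sz /= sz.
  rewrite leqn0 => ->; apply/esym/eqP; rewrite -leqn0 leqNgt BLB.1 Ew.
  by apply/imsetP => -[p]; rewrite inE !perm1; lia.
have [Bw _] := BLB.
have BM x : B x <= max_label T by apply: max_label_ge.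
have corner_ex (r j : 'I_n) : B (r, w j) = max_label T -> 0 < max_label T ->
    exists i i' : 'I_n, [/\ i' = i.+1 :> nat, i' <= j, w i' < w i,
      B (i, w i') = max_label T & descent_cell w i i' \in max_corners T].
  move=> rM M0; have : 0 < B (r, w j) by rewrite rM.
  rewrite Bw mem_rothe => /andP[rj _].
  have [i [i' [hi _ ij iM]]] := max_label_desc BLB BM rj rM.
  have : 0 < B (i, w i') by rewrite iM.
  rewrite Bw mem_rothe => /andP[_ wi]; exists i, i'; split=> //.
  exact: descent_max_corner.
have [[r s] rw rM] : exists2 x, x \in rothe w & B x = max_label T.
  by apply/mem_sort_columns/mem_max_label; rewrite -/T sz.
have M0 : 0 < max_label T by rewrite -rM Bw.
rewrite -(permKV w s) in rM; have [k [k' [_ _ _ _ kC]]] := corner_ex _ _ rM M0.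
have [c Ec] := pivot_exists kC; have [cC cmin] := pivotP Ec.
have hc := pivot_top Ec; have sT : shape T = code w := shape_sort_columns w B.
move: cC; rewrite mem_max_corners sT => /andP[/corner_code[i [i' [hi wi EcD fl fli]]] /eqP lc].
(* A column [w i'] may contain the maximal label outside of [(i, w i')], as in
   the labelling 2 2 / 1 of 321, but not for the least such descent. *)
have iM : B (i, w i') = max_label T.
  have [q qM] : exists q, B (q, w i') = max_label T.
    have : label T c \in nth [::] T (w i').
      have [_ _ sc] := top_cellP hc; have c1 : c.1.-1 = w i' by rewrite EcD.
      by rewrite /label -c1 mem_nth // sc.
    rewrite nth_sort_columns mem_sort lc => /mapP[q _ ->].
    by exists q.
  (* The maximal label at [(q, w i')] yields a descent ending at [i'] or before; the minimal flight
     number of the pivot makes it [i]. *)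
  have [j [j' [hj jq wj jM jC]]] := corner_ex _ _ qM M0.
  have := cmin _ jC; rewrite sT fli; have [_ ->] := descent_corner hj wj.
  rewrite ltnS => ij; have Eij : i = j by apply: val_inj => /=; lia.
  have Ej : j' = i' by apply: val_inj; rewrite /= hj hi Eij.
  by rewrite Eij -Ej.
set B0 := del_cell w i i' B.
have BL0 : BL (tperm i i' * w)%g B0.
  by apply: BL_del_cell => // x; rewrite iM.
have le x : B0 x <= max_label T by rewrite ffunE; case: ifP.
have EB : B = add_cell w i i' (max_label T) B0 by rewrite -iM del_cellK.
have [hpos ET] := sort_columns_add_cell hi wi le.
rewrite -EB -/T in ET.
have ER : restrict T c = sort_columns (tperm i i' * w)%g B0.
  by rewrite ET EcD restrict_put_label // size_sort_columns; apply: ltn_ord.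
have sz0 : size (flatten (sort_columns (tperm i i' * w)%g B0)) = m.
  by rewrite -ER; apply: eq_add_S; rewrite -size_flatten_restrict.
have [ss0 R0] := IH _ _ BL0 sz0.
have tT0 := tower_tableau_sort_columns BL0.1.
(* The reduced word of the smaller standardization is supplied by the other direction. *)
have [_ _ [alpha red0 hU0]] := rothify_semistandard sz0 (shape_sort_columns _ _) tT0 ss0.
rewrite -ER in hU0.
have [_ _ ->] := rothify_add_cell hi wi sT Ec EcD fl red0 hU0.
split; first by rewrite semistandardE Ec ER ss0 orbT.
by rewrite ER R0 lc -EB.
Qed.

(** [tower_diagram] quantifies over all reduced words, so the existence of one is what pins [D]
    down. *)
Lemma tower_diagram_code n (w : 'S_n) D : tower_diagram w D -> D = code w.
Proof.
move=> hD; have [alpha red] := reduced_word_exists w.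
have [T hT <-] := hD alpha red; have [U [hU sU _]] := std_tableau_reduced_word red.
by move: sU; rewrite hT in hU; case: hU => ->.
Qed.

Theorem mainTheorem7 (n : nat) (w : 'S_n) (D : diagram)
    (hD : tower_diagram w D) :
  [/\ set_bij (BL w) (SSTT D) (sort_columns w),
      forall T : tableau, SSTT D T -> BL w (rothify n T),
      forall B : labelling n, BL w B -> rothify n (sort_columns w B) = B
    & forall T : tableau, SSTT D T -> sort_columns w (rothify n T) = T].
Proof.
rewrite (tower_diagram_code hD).
have toT B : BL w B -> SSTT (code w) (sort_columns w B).
  move=> BLB; split; first exact: shape_sort_columns.
    exact: tower_tableau_sort_columns BLB.1.
  exact: (sort_columns_semistandard BLB erefl).1.
have toB T : SSTT (code w) T -> BL w (rothify n T) /\ sort_columns w (rothify n T) = T.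
  by case=> sT tT ssT; have [] := rothify_semistandard erefl sT tT ssT.
have rK B : BL w B -> rothify n (sort_columns w B) = B.
  by move=> BLB; exact: (sort_columns_semistandard BLB erefl).2.
split=> //; last 2 first.
- by move=> T /toB[].
- by move=> T /toB[].
split=> //.
- by move=> B C; rewrite !inE => hB hC E; rewrite -(rK B) // E rK.
- by move=> T /toB[h1 h2]; exists (rothify n T).
Qed.
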